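(* Let $0<\gamma<1$ and consider the two-level generalized random energy model with weights $a_1,a_2>0$, limiting proportions $p_1,p_2$ and driving density $\phi_{N,\gamma}$, as described in the context. Then almost surely the limiting free energy $\mathcal{E}(\beta)=\lim_{N\to\infty}\frac1N\log Z_N(\beta)$ is as follows. (1) If $a_2(\log2)^{\frac1\gamma}\le a_1(p_1\log2)^{\frac1\gamma}+a_2(p_2\log2)^{\frac1\gamma}$, then $$\mathcal{E}(\beta)=\begin{cases}\log2&\text{for }0\le\beta\le\frac1{a_1\gamma^{1/\gamma}(p_1\log2)^{(1-\gamma)/\gamma}},\\ p_2\log2+\beta a_1(\gamma p_1\log2)^{\frac1\gamma}&\text{for }\frac1{a_1\gamma^{1/\gamma}(p_1\log2)^{(1-\gamma)/\gamma}}\le\beta\le\frac1{a_2\gamma^{1/\gamma}(p_2\log2)^{(1-\gamma)/\gamma}},\\ \beta\left(a_1(\gamma p_1\log2)^{\frac1\gamma}+a_2(\gamma p_2\log2)^{\frac1\gamma}\right)&\text{for }\beta\ge\frac1{a_2\gamma^{1/\gamma}(p_2\log2)^{(1-\gamma)/\gamma}}.\end{cases}$$ (2) If $a_2(\log2)^{\frac1\gamma}>a_1(p_1\log2)^{\frac1\gamma}+a_2(p_2\log2)^{\frac1\gamma}$ and $a_2(\log2)^{\frac{1-\gamma}\gamma}\le a_1(p_1\log2)^{\frac{1-\gamma}\gamma}$, then $$\mathcal{E}(\beta)=\begin{cases}\log2&\text{for }0\le\beta\le\frac1{a_1\gamma^{1/\gamma}(p_1\log2)^{(1-\gamma)/\gamma}},\\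 p_2\log2+\beta a_1(\gamma p_1\log2)^{\frac1\gamma}&\text{for }\frac1{a_1\gamma^{1/\gamma}(p_1\log2)^{(1-\gamma)/\gamma}}\le\beta\le\frac{p_2\log2}{a_2(\gamma\log2)^{1/\gamma}-a_1(\gamma p_1\log2)^{1/\gamma}},\\ \beta a_2(\gamma\log2)^{\frac1\gamma}&\text{for }\beta\ge\frac{p_2\log2}{a_2(\gamma\log2)^{1/\gamma}-a_1(\gamma p_1\log2)^{1/\gamma}}.\end{cases}$$ (3) If $a_2(\log2)^{\frac1\gamma}>a_1(p_1\log2)^{\frac1\gamma}+a_2(p_2\log2)^{\frac1\gamma}$ and $a_2(\log2)^{\frac{1-\gamma}\gamma}>a_1(p_1\log2)^{\frac{1-\gamma}\gamma}$, then $$\mathcal{E}(\beta)=\begin{cases}\log2&\text{for }0\le\beta\le\frac1{a_2\gamma^{1/\gamma}(\log2)^{(1-\gamma)/\gamma}},\\ \beta a_2(\gamma\log2)^{\frac1\gamma}&\text{for }\beta\ge\frac1{a_2\gamma^{1/\gamma}(\log2)^{(1-\gamma)/\gamma}}.\end{cases}$$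
   Context: Model: for each $N\ge2$ let $k(1,N),k(2,N)\ge1$ be integers with $k(1,N)+k(2,N)=N$ and $\frac{k(i,N)}N\to p_i$ as $N\to\infty$, with $p_1>0$. Write $\sigma\in\{+1,-1\}^N$ as $\sigma_1\sigma_2$ with $\sigma_i\in\{+1,-1\}^{k(i,N)}$. For each $N$ the random variables $\xi(\sigma_1)$ and $\xi(\sigma_1\sigma_2)$ (over all $\sigma_1,\sigma_2$) are i.i.d. with density $$\phi_{N,\gamma}(x)=\frac1{2\Gamma(\frac1\gamma)}\left(\frac\gamma N\right)^{\frac{\gamma-1}\gamma}e^{-\frac{|x|^\gamma}{\gamma N^{\gamma-1}}},\quad-\infty<x<\infty,$$ all $N$ on one probability space. $H_N(\sigma)=a_1\xi(\sigma_1)+a_2\xi(\sigma_1\sigma_2)$ and $Z_N(\beta)=\sum_\sigma e^{-\beta H_N(\sigma)}$. If $p_2=0$, a quotient $1/0$ is read as $+\infty$. *)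

(* Defs.v *)
From mathcomp Require Import all_boot all_order all_algebra.
From mathcomp Require Import all_classical all_reals all_analysis.

Set Implicit Arguments.
Unset Strict Implicit.
Unset Printing Implicit Defensive.

Import Order.TTheory GRing.Theory Num.Theory.
Import numFieldNormedType.Exports.

Local Open Scope classical_set_scope.
Local Open Scope ring_scope.

Definition Gamma {R : realType} (s : R) : R :=
  \int[lebesgue_measure]_(x in `]0, +oo[) (x `^ (s - 1) * expR (- x)).

Definition driving_density {R : realType} (N : nat) (gamma x : R) : R :=
  1 / (2 * Gamma (1 / gamma)) * (gamma / N%:R) `^ ((gamma - 1) / gamma) *
  expR (- (`|x| `^ gamma / (gamma * N%:R `^ (gamma - 1)))).

Definition mutually_independent {d : measure_display} {T : measurableType d}
    {R : realType} (P : probability T R) (I : finType)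
    (X : I -> {RV P >-> R}) : Prop :=
  forall (J : {set I}) (B : I -> set R), (forall i, measurable (B i)) ->
    P (\bigcap_(i in [set` J]) (X i @^-1` B i)) =
    (\prod_(i in J) P (X i @^-1` B i))%E.

Definition has_density {d : measure_display} {T : measurableType d}
    {R : realType} (P : probability T R) (X : {RV P >-> R}) (f : R -> R) :
    Prop :=
  forall A : set R, measurable A ->
    distribution P X A = (\int[lebesgue_measure]_(x in A) (f x)%:E)%E.

(* {+1, -1}^n, with the booleans standing for the two signs *)
Definition spins (n : nat) : finType := {ffun 'I_n -> bool}.

(* Indices of the driving variables of a two-level model with blocks of sizes
   k1 and k2: inl s1 is the index of xi(s1) and inr (s1, s2) that of
   xi(s1 s2). *)
Definition grem_index (k1 k2 : nat) : finType :=
  (spins k1 + spins k1 * spins k2)%type.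

(* A configuration s1 s2 is represented by the pair s = (s1, s2). *)
Definition hamiltonian {R : realType} (k1 k2 : nat) (a1 a2 : R)
    (xi : grem_index k1 k2 -> R) (s : spins k1 * spins k2) : R :=
  a1 * xi (inl s.1) + a2 * xi (inr s).

Definition partition_function {R : realType} (k1 k2 : nat) (a1 a2 : R)
    (xi : grem_index k1 k2 -> R) (beta : R) : R :=
  \sum_(s : spins k1 * spins k2) expR (- beta * hamiltonian a1 a2 xi s).

(* Extended-real valued, so that the value at x = 0 is 1 / 0 = +oo. *)
Definition critical_beta {R : realType} (gamma a x : R) : \bar R :=
  (1 / (a * gamma `^ (1 / gamma) * x `^ ((1 - gamma) / gamma))%:E)%E.

(* Main.v *)
Require Import Defs.
From HB Require Import structures.
From mathcomp Require Import all_boot all_order all_algebra.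
From mathcomp Require Import all_classical all_reals all_analysis.
From mathcomp Require Import measurable_realfun.
From mathcomp Require Import ring lra.

Set Implicit Arguments.
Unset Strict Implicit.
Unset Printing Implicit Defensive.

Import Order.TTheory GRing.Theory Num.Theory.
Import numFieldNormedType.Exports.

Local Open Scope classical_set_scope.
Local Open Scope ring_scope.

(** Measure a value [x] of a driving variable by its cost
    |x|^gamma / (gamma N^(gamma-1)), minus the logarithm of the density up to
    its constant. Per unit of N, a pair of costs u1, u2 for the two variables
    of a configuration is met by about exp(N (L - u1 - u2)) configurations,
    L = ln 2, and can be met only if u1 <= p1 L (there are 2^(k1 N) first
    blocks) and u1 + u2 <= L (there are 2^N configurations). Such a
    configuration has energy -N (a1 (gamma u1)^(1/gamma) +
    a2 (gamma u2)^(1/gamma)) when both variables are negative. So the free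
    energy is the maximum over that polygon of

      L + c1 u1^(1/gamma) + c2 u2^(1/gamma) - u1 - u2,
      c_i = beta a_i gamma^(1/gamma).

    As gamma < 1 this function is convex, and the maximum is taken at one of
    the vertices (0,0), (p1 L, 0), (p1 L, p2 L), (0, L). Comparing the four
    vertex values yields the phases.

    Upper bound. The density of parameter N times the exponential of the cost,
    reduced by a factor tending to 1, is a multiple of the density of parameter
    2, which has mass 1: the exponential moments of these reduced costs are
    powers of N ([cost_tilt]). The corresponding exponential sums over the first
    blocks and over all configurations are therefore, almost surely and for all
    large N, at most N^2 times their means ([ae_tilted_sums]). Since each term is
    below the sum, this confines all cost pairs to a slightly enlarged polygon,
    where convexity bounds every Gibbs weight by exp(N vertex_max) times its
    tilted term ([vertex_value_le_max], [ln_partition_function_le]).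

    Lower bound. For cost levels below the entropy, the number of
    configurations whose two variables lie below the corresponding negative
    levels is concentrated, by Chebyshev's inequality: two configurations are
    independent unless they share the first block ([block_count_lower_tail]).
    Applied to four sequences of levels that converge to the four vertices, this
    gives a matching bound ([ae_partition_function_ge]).

    All exceptional events have probability O(1/N^2) and do not involve beta,
    so the limit holds almost surely for all beta at once
    ([ae_free_energy]). *)

(** * Densities and independence *)

Section density.
Context d (T : measurableType d) (R : realType) (nu : {measure set T -> \bar R})
  (mu : {measure set T -> \bar R}) (f : T -> R) (mf : measurable_fun setT f)
  (f0 : forall x, 0 <= f x)
  (nuE : forall A, measurable A -> nu A = (\int[mu]_(x in A) (f x)%:E)%E).

Import HBNNSimple.

Lemma integral_density_nnsfun (g : {nnsfun T >-> R}) :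
  (\int[nu]_x (g x)%:E = \int[mu]_x ((g x)%:E * (f x)%:E))%E.
Proof.
under [LHS]eq_integral do rewrite fimfunE -fsumEFin//.
rewrite [LHS]ge0_integral_fsum//; last 2 first.
  - by move=> r; exact/measurable_EFinP/measurableT_comp.
  - by move=> n x _; rewrite EFinM nnfun_muleindic_ge0.
under [RHS]eq_integral.
  move=> x xD; rewrite fimfunE -fsumEFin// ge0_mule_fsuml; last first.
    by move=> r; rewrite EFinM nnfun_muleindic_ge0.
  over.
rewrite [RHS]ge0_integral_fsum//; last 2 first.
  - move=> r; rewrite /=; under eq_fun do rewrite -EFinM.
    apply/measurable_EFinP; apply: measurable_funM => //.
    exact: measurableT_comp.
  - move=> n x _; apply: mule_ge0; last by rewrite lee_fin.
    by rewrite EFinM nnfun_muleindic_ge0.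
apply: eq_fsbigr => r _.
have mr : measurable (g @^-1` [set r]) by [].
rewrite !integralZl_indic_nnsfun//= integral_indic// setIT nuE//.
have [rg|] := boolP (r \in range g); last first.
  rewrite notin_setE => rg; rewrite preimage10// integral_set0 mule0.
  rewrite integral0_eq// => x _; rewrite indic0 mulr0 mul0e//.
have r0 : 0 <= r by move: rg; rewrite inE => -[x _ <-].
rewrite -ge0_integralZl//; last 2 first.
  - by apply/measurable_EFinP/measurable_funTS.
  - by move=> x _; rewrite lee_fin.
rewrite integral_mkcond/=; apply: eq_integral => x _.
rewrite patchE indicE; case: ifPn => _; rewrite ?mulr1 ?mulr0 ?mul0e//.
Qed.

(** Both sides agree on simple functions and are continuous along
    increasing approximations. This is the change of measure behind the tilting
    of the driving density. *)
Lemma ge0_integral_density (g : T -> \bar R) :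
  measurable_fun setT g -> (forall x, 0 <= g x)%E ->
  (\int[nu]_x g x = \int[mu]_x (g x * (f x)%:E))%E.
Proof.
move=> mg g0.
pose g_ := nnsfun_approx measurableT mg.
transitivity (limn (fun n => \int[nu]_x (g_ n x)%:E))%E.
  rewrite -monotone_convergence//=.
  - apply: eq_integral => x _; apply/esym/cvg_lim => //.
    exact: cvg_nnsfun_approx.
  - by move=> n; exact/measurable_EFinP/measurable_funP.
  - by move=> n x _; rewrite lee_fin.
  - by move=> x _ m n mn; rewrite lee_fin; exact/lefP/nd_nnsfun_approx.
under eq_fun do rewrite integral_density_nnsfun.
rewrite -monotone_convergence//=.
- apply: eq_integral => x _; apply/cvg_lim => //.
  by apply: cvgeZr => //; exact: cvg_nnsfun_approx.
- move=> n; apply: emeasurable_funM; last exact/measurable_EFinP.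
  exact/measurable_EFinP/measurable_funP.
- by move=> n x _; rewrite mule_ge0// lee_fin.
- move=> x _ m n mn; rewrite lee_wpmul2r ?lee_fin//; exact/lefP/nd_nnsfun_approx.
Qed.
End density.

Section independent_pair.
Local Open Scope ereal_scope.
Context d (T : measurableType d) (R : realType) (P : probability T R).

(** The product rule on rectangles identifies the joint law with the
    product of the marginal laws, and the integral factorizes by Tonelli. *)
Lemma ge0_integral_indep_mul (X Y : {RV P >-> R}) (f g : R -> \bar R) :
  (forall A B, measurable A -> measurable B ->
     P (X @^-1` A `&` Y @^-1` B) = P (X @^-1` A) * P (Y @^-1` B)) ->
  measurable_fun setT f -> measurable_fun setT g ->
  (forall x, 0 <= f x) -> (forall x, 0 <= g x) ->
  \int[P]_w (f (X w) * g (Y w)) = \int[P]_w f (X w) * \int[P]_w g (Y w).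
Proof.
move=> ind mf mg f0 g0.
have mXY : measurable_fun setT (fun w => (X w, Y w)).
  by apply/measurable_fun_prod.
pose XY : {mfun T >-> (R * R)%type} :=
  HB.pack (fun w => (X w, Y w)) (isMeasurableFun.Build _ _ _ _ _ mXY).
pose F (z : R * R) := f z.1 * g z.2.
have mF : measurable_fun setT F.
  by apply: emeasurable_funM; exact: measurableT_comp.
have F0 z : 0 <= F z by apply: mule_ge0.
rewrite -[LHS](ge0_integral_distribution XY mF F0).
rewrite -(ge0_integral_distribution X mf f0) -(ge0_integral_distribution Y mg g0).
have distXY A : measurable A -> A `<=` setT ->
    distribution P XY A = (distribution P X \x distribution P Y) A.
  by move=> mA _; apply/esym/product_measure_unique.
rewrite (eq_measure_integral _ distXY).
rewrite fubini_tonelli1//= /fubini_F /F/=.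
transitivity (\int[distribution P X]_x (f x * \int[distribution P Y]_y g y)).
  by apply: eq_integral => x _; rewrite ge0_integralZl.
by rewrite ge0_integralZr// integral_ge0.
Qed.
End independent_pair.

(** * Almost sure eventual bounds from moments *)

(** The convergence half of Borel-Cantelli, for probabilities of order 1/n^2. It
    suits events that come from models of different sizes, whose joint law is
    arbitrary. *)
Lemma borel_cantelli_sqr d (T : measurableType d) (R : realType)
    (P : {measure set T -> \bar R}) (B : (set T)^nat) (c : R) :
  (forall n, measurable (B n)) ->
  (forall n, (2 <= n)%N -> (P (B n) <= (c / n%:R ^+ 2)%:E)%E) ->
  {ae P, forall w, \forall n \near \oo, ~ B n w}.
Proof.
move=> mB Bc.
have c0 : 0 <= c.
  have P0 : (0 <= P (B 2%N))%E by [].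
  have := le_trans P0 (Bc 2%N isT).
  rewrite lee_fin => h; rewrite -(@pmulr_lge0 _ (2%N%:R ^+ 2)^-1)//.
pose F n := B n.+2.
exists (lim_sup_set F); split.
- apply: bigcap_measurable => [|k _]; first by exists 0%N.
  by apply: bigcup_measurable => *; exact: mB.
- apply: lim_sup_set_cvg0 => // [k|]; first exact: mB.
  apply: (@le_lt_trans _ _ c%:E); last exact: ltry.
  apply: lime_le; first exact: is_cvg_nneseries.
  apply: nearW => n.
  (* 1 / (n + 2)^2 is at most 1 / (n + 1) - 1 / (n + 2), whose sum telescopes. *)
  apply: (@le_trans _ _ (c * (1 - n.+1%:R^-1))%:E); last first.
    by rewrite lee_fin ler_piMr// gerBl invr_ge0.
  elim: n => [|n ih]; first by rewrite big_geq// invr1 subrr mulr0.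
  rewrite big_nat_recr//=; apply: le_trans (leeD ih (Bc n.+2 isT)) _.
  rewrite -EFinD lee_fin -mulrDr ler_wpM2l//.
  rewrite -!natr1; set x : R := n%:R.
  have x0 : 0 <= x by rewrite /x.
  rewrite -subr_ge0 (_ : _ - _ = (x + 1)^-1 * ((x + 1 + 1) ^- 2)).
    by rewrite mulr_ge0// ?invr_ge0 ?exprn_ge0//; lra.
  by field; apply/andP; split; rewrite gt_eqF//; lra.
- move=> w /= nw n _; apply: contrapT => nF; apply: nw.
  exists n.+2 => // m /= nm Bm; apply: nF; exists m.-2 => /=.
    by rewrite -ltnS -ltnS; case: m nm {Bm} => [|[|m]].
  by rewrite /F; case: m nm Bm => [|[|m]].
Qed.

Lemma borel_cantelli_sqr_near d (T : measurableType d) (R : realType)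
    (P : {measure set T -> \bar R}) (B : (set T)^nat) (c : R) : 0 <= c ->
  (forall n, measurable (B n)) ->
  (\forall n \near \oo, (P (B n) <= (c / n%:R ^+ 2)%:E)%E) ->
  {ae P, forall w, \forall n \near \oo, ~ B n w}.
Proof.
move=> c0 mB [M _ Bc].
pose C n := if (M <= n)%N then B n else set0.
have mC n : measurable (C n) by rewrite /C; case: ifP.
have PC n : (2 <= n)%N -> (P (C n) <= (c / n%:R ^+ 2)%:E)%E.
  move=> _; rewrite /C; case: ifP => [Mn|_]; first exact: Bc.
  by rewrite measure0 lee_fin divr_ge0// exprn_ge0.
apply: filterS (borel_cantelli_sqr mC PC) => w Cw.
near=> n => Bn.
have Mn : (M <= n)%N by near: n; exact: nbhs_infty_ge.
have : ~ C n w by near: n.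
by rewrite /C Mn.
Unshelve. all: by end_near. Qed.

Section counting.
Local Open Scope ereal_scope.
Context d (T : measurableType d) (R : realType) (P : probability T R).

(** Chebyshev's inequality for a sum of indicators; [v] bounds its variance,
    which is the excess of the pair probabilities over the square of the
    mean [m]. *)
Lemma count_lower_tail (I : finType) (A : I -> set T) (m v : R) :
  (forall i, measurable (A i)) -> (0 < m)%R ->
  \sum_i P (A i) = m%:E ->
  \sum_i \sum_j P (A i `&` A j) <= (m ^+ 2 + v)%:E ->
  P [set w | (\sum_i \1_(A i) w <= m / 2)%R] <= (4 * v / m ^+ 2)%:E.
Proof.
move=> mA m0 sum1 sum2.
pose X w : R := (\sum_i \1_(A i) w)%R.
have mX : measurable_fun setT X.
  by apply: measurable_sum => i; exact: measurable_indic.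
have X0 w : (0 <= X w)%R by apply: sumr_ge0.
have EX : \int[P]_w (X w)%:E = m%:E.
  rewrite -sum1 /X; under eq_integral do rewrite -sumEFin.
  rewrite ge0_integral_sum//; last first.
    by move=> i; apply/measurable_EFinP/measurable_indic.
  by apply: eq_bigr => i _; rewrite integral_indic// setIT.
have EX2 : \int[P]_w (X w ^+ 2)%:E <= (m ^+ 2 + v)%:E.
  apply: le_trans sum2; rewrite /X.
  have XE w : ((X w) ^+ 2)%:E = \sum_i \sum_j (\1_(A i `&` A j) w)%:E.
    rewrite expr2 /X mulr_suml -sumEFin; apply: eq_bigr => i _.
    rewrite mulr_sumr -sumEFin; apply: eq_bigr => j _.
    by rewrite indicI.
  under eq_integral do rewrite XE.
  have mI i j : measurable (A i `&` A j) by exact: measurableI.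
  rewrite ge0_integral_sum//; last 2 first.
  - move=> i; apply: emeasurable_sum => j.
    by apply/measurable_EFinP/measurable_indic.
  - by move=> i w _; apply: sume_ge0 => j _; rewrite lee_fin.
  apply: lee_sum => i _; rewrite ge0_integral_sum//; last first.
    by move=> j; apply/measurable_EFinP/measurable_indic.
  by apply: lee_sum => j _; rewrite integral_indic// setIT.
have mXm : measurable_fun setT (fun w => ((X w - m) ^+ 2)%:E).
  by apply/measurable_EFinP/measurable_funX/measurable_funB.
have Evar : \int[P]_w ((X w - m) ^+ 2)%:E <= v%:E.
  (* The square is expanded with all terms moved to the side where they are
     nonnegative, where the integral is additive. *)
  have : \int[P]_w ((X w - m) ^+ 2)%:E + \int[P]_w (2 * m * X w)%:E
      = \int[P]_w (X w ^+ 2)%:E + \int[P]_w (m ^+ 2)%:E.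
    have m1 : measurable_fun setT (fun w => (2 * m * X w)%:E).
      by apply/measurable_EFinP/measurable_funM.
    have m2 : measurable_fun setT (fun w => (X w ^+ 2)%:E).
      by apply/measurable_EFinP/measurable_funX.
    have s0 w : setT w -> 0 <= ((X w - m) ^+ 2)%:E.
      by rewrite lee_fin sqr_ge0.
    have c1 w : setT w -> 0 <= (2 * m * X w)%:E.
      by rewrite lee_fin !mulr_ge0// ltW.
    have c2 w : setT w -> 0 <= (X w ^+ 2)%:E by rewrite lee_fin sqr_ge0.
    have c3 (w : T) : setT w -> 0 <= (m ^+ 2)%:E by rewrite lee_fin sqr_ge0.
    rewrite -ge0_integralD// -ge0_integralD//.
    by apply: eq_integral => w _; rewrite -!EFinD; congr EFin; ring.
  under [X in _ + X = _]eq_integral do rewrite EFinM.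
  have mXE : measurable_fun setT (fun w => (X w)%:E) by exact/measurable_EFinP.
  have XE0 w : setT w -> 0 <= (X w)%:E by rewrite lee_fin.
  have m20 : 0 <= (2 * m)%:E by rewrite lee_fin mulr_ge0// ltW.
  rewrite ge0_integralZl//.
  rewrite EX integral_cst//.
  rewrite [X in _ = _ + _ * X](@probability_setT _ _ _ P) mule1 => E.
  have : \int[P]_w ((X w - m) ^+ 2)%:E + (2 * m * m)%:E <= (m ^+ 2 + v + m ^+ 2)%:E.
    by rewrite EFinM E EFinD leeD2r.
  rewrite (_ : (m ^+ 2 + v + m ^+ 2)%R = (v + 2 * m * m)%R); last by ring.
  by rewrite EFinD leeD2rE.
pose S := [set w | (X w <= m / 2)%R].
have mS : measurable S.
  rewrite (_ : S = X @^-1` `]-oo, (m / 2)%R]).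
    by rewrite -[_ @^-1` _]setTI; exact: mX.
  by apply/seteqP; split => w /=; rewrite in_itv.
have h : (m ^+ 2 / 4)%:E * P S <= v%:E.
  apply: le_trans Evar; rewrite -integral_cst//.
  apply: (@le_trans _ _ (\int[P]_(w in S) ((X w - m) ^+ 2)%:E)).
    apply: ge0_le_integral => //.
    - by move=> w _; rewrite lee_fin divr_ge0// sqr_ge0.
    - exact: measurable_funTS.
    - by move=> w Sw; rewrite /= lee_fin; move: (Sw : (X w <= m / 2)%R); nra.
  by apply: ge0_subset_integral => // w _; rewrite lee_fin sqr_ge0.
rewrite -/S (_ : (4 * v / m ^+ 2)%:E = (m ^+ 2 / 4)^-1%:E * v%:E); last first.
  by rewrite -EFinM; congr EFin; field; rewrite gt_eqF.
by rewrite lee_pdivlMl// divr_gt0// exprn_gt0.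
Qed.
End counting.

Lemma markov_tail d (T : measurableType d) (R : realType) (P : probability T R)
    (W : T -> R) (c n : R) :
  measurable_fun setT W -> (forall w, 0 <= W w) -> 0 < c -> 0 < n ->
  (\int[P]_w (W w)%:E <= c%:E)%E ->
  (P [set w | (n * c <= W w)%R] <= (n^-1)%:E)%E.
Proof.
move=> mW W0 c0 n0 EW.
pose S := [set w | n * c <= W w].
have mS : measurable S.
  rewrite (_ : S = W @^-1` `[n * c, +oo[%classic).
    by rewrite -[_ @^-1` _]setTI; exact: mW.
  by apply/seteqP; split => w /=; rewrite in_itv/= andbT.
have h : ((n * c)%:E * P S <= c%:E)%E.
  apply: le_trans EW; rewrite -integral_cst//.
  apply: (@le_trans _ _ (\int[P]_(w in S) (W w)%:E)%E).
    apply: ge0_le_integral => //.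
    - by move=> w _; rewrite lee_fin mulr_ge0// ltW.
    - exact/measurable_EFinP/measurable_funTS.
  apply: ge0_subset_integral => //; first exact/measurable_EFinP.
  by move=> w _; rewrite lee_fin.
rewrite -/S (_ : (n^-1)%:E = (n * c)^-1%:E * c%:E)%E; last first.
  by rewrite -EFinM; congr EFin; field; rewrite !gt_eqF.
by rewrite lee_pdivlMl// mulr_gt0.
Qed.

(** * The driving density *)

Lemma powR_invr (R : realType) (x a : R) : 0 <= x -> x^-1 `^ a = (x `^ a)^-1.
Proof. by move=> x0; rewrite -powR_inv1// -powRrM mulN1r powRN. Qed.

Section driving.
Context d (T : measurableType d) (R : realType) (P : probability T R) (gamma : R)
  (gamma_gt0 : 0 < gamma).

(** Minus the exponent of the driving density. *)
Definition cost (gamma : R) (N : nat) (x : R) : R :=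
  `|x| `^ gamma / (gamma * N%:R `^ (gamma - 1)).

Definition density_const (gamma : R) (N : nat) : R :=
  1 / (2 * Gamma (1 / gamma)) * (gamma / N%:R) `^ ((gamma - 1) / gamma).

Lemma driving_densityE N x :
  driving_density N gamma x = density_const gamma N * expR (- cost gamma N x).
Proof. by []. Qed.

Lemma measurable_cost N : measurable_fun setT (cost gamma N).
Proof.
apply: measurable_funM => //.
exact: (measurableT_comp (f := fun x => x `^ gamma)).
Qed.

Lemma measurable_driving_density N : measurable_fun setT (driving_density N gamma).
Proof.
apply: measurable_funM => //; apply: measurableT_comp => //.
by apply: measurableT_comp => //; exact: measurable_cost.
Qed.

Lemma measurable_EFin_driving_density N (D : set R) :
  measurable_fun D (fun x => (driving_density N gamma x)%:E).
Proof.
by apply/measurable_EFinP; apply: measurable_funTS; apply: measurable_driving_density.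
Qed.

Lemma density_const_ge0 N : 0 <= density_const gamma N.
Proof.
rewrite mulr_ge0 ?powR_ge0// divr_ge0// mulr_ge0// /Gamma /Rintegral.
by apply: fine_ge0; apply: integral_ge0 => x _; rewrite lee_fin mulr_ge0 ?powR_ge0 ?expR_ge0.
Qed.

Lemma driving_density_ge0 N x : 0 <= driving_density N gamma x.
Proof. by rewrite driving_densityE mulr_ge0 ?density_const_ge0 ?expR_ge0. Qed.

(** The integral defining the Gamma function would be 0 by convention if
    it diverged, but a density of total mass 1 has no factor 0. *)
Lemma density_const_gt0 N (X : {RV P >-> R}) :
  has_density X (driving_density N gamma) -> 0 < density_const gamma N.
Proof.
move=> hX; rewrite lt_neqAle density_const_ge0 andbT; apply/eqP => c0.
have := hX setT measurableT.
rewrite (_ : distribution P X setT = 1%E); last exact: probability_setT.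
rewrite integral0_eq => [/eqP|x _]; first by rewrite eqe oner_eq0.
by rewrite driving_densityE -c0 mul0r.
Qed.

Lemma density_constE N : (0 < N)%N -> density_const gamma N =
  (N%:R / 2) `^ ((1 - gamma) / gamma) * density_const gamma 2.
Proof.
move=> N0; rewrite /density_const mulrCA; congr (_ * _).
have N0' : 0 < N%:R :> R by rewrite ltr0n.
rewrite (_ : (gamma - 1) / gamma = - ((1 - gamma) / gamma)); last by rewrite -mulNr opprB.
rewrite !powRN !powRM ?invr_ge0 ?ler0n ?ltW//.
set h := (1 - gamma) / gamma.
rewrite !powR_invr ?ler0n ?ltW//; field.
by rewrite !gt_eqF// powR_gt0.
Qed.

(** The integrand turns the density of parameter [N] into a multiple of the
    one of parameter 2, whose total mass is 1; what remains is the ratio of the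
    two constants, a power of [N]. The parameter 2 is the smallest one of the
    model, hence tilts the most. *)
Lemma cost_tilt N (X X2 : {RV P >-> R}) : (0 < N)%N ->
  has_density X (driving_density N gamma) ->
  has_density X2 (driving_density 2 gamma) ->
  (\int[P]_w (expR (cost gamma N (X w) - cost gamma 2 (X w)))%:E
   = ((N%:R / 2) `^ ((1 - gamma) / gamma))%:E)%E.
Proof.
move=> N0 hX hX2.
have mg : measurable_fun setT
    (fun x => (expR (cost gamma N x - cost gamma 2 x))%:E).
  apply/measurable_EFinP; apply: measurableT_comp => //.
  by apply: measurable_funB; exact: measurable_cost.
(* The Lebesgue measure is defined on another instance of the same
   sigma-algebra of the line; X is repackaged with values there. *)
have mX : measurable_fun setT (X : T -> measurableTypeR R).
  move=> mT B mB; exact: (@measurable_funP _ _ _ _ setT X mT B mB).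
pose Y : {mfun T >-> measurableTypeR R} :=
  HB.pack (X : T -> measurableTypeR R) (isMeasurableFun.Build _ _ _ _ _ mX).
pose tilt (x : measurableTypeR R) := (expR (cost gamma N x - cost gamma 2 x))%:E.
have tilt0 x : (0 <= tilt x)%E by rewrite lee_fin expR_ge0.
rewrite -[LHS](@ge0_integral_distribution _ _ _ _ _ P Y tilt mg tilt0).
rewrite (@ge0_integral_density _ _ R (distribution P Y) (@lebesgue_measure R) _
  (measurable_driving_density N) (driving_density_ge0 N) hX tilt mg tilt0).
under eq_integral.
  move=> x _.
  rewrite -EFinM (_ : _ * _ = (N%:R / 2) `^ ((1 - gamma) / gamma) * driving_density 2 gamma x).
    rewrite EFinM; over.
  rewrite !driving_densityE (density_constE N0).
  rewrite /tilt expRB !expRN; field.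
  by rewrite !gt_eqF ?expR_gt0.
rewrite ge0_integralZl//.
- by rewrite -hX2// (_ : distribution P X2 setT = 1%E) ?mule1//; exact: probability_setT.
- exact: measurable_EFin_driving_density.
- by move=> x _; rewrite lee_fin driving_density_ge0.
Qed.

(** The density at the far end of an interval of length 1 below [-t]
    bounds the mass of that interval. The loss from [t] to [t + 1] is of
    order N^(1-gamma), negligible with respect to N. *)
Lemma lower_tail N (X : {RV P >-> R}) (t : R) :
  0 <= t -> has_density X (driving_density N gamma) ->
  ((density_const gamma N * expR (- cost gamma N (t + 1)))%:E
    <= P (X @^-1` `]-oo, (- t)%R]))%E.
Proof.
move=> t0 hX; rewrite [leRHS]hX//.
apply: (@le_trans _ _ (\int[lebesgue_measure]_(x in `[(- (t + 1))%R, (- t)%R]%classic)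
    (driving_density N gamma x)%:E)%E); last first.
  apply: ge0_subset_integral => //.
  - exact: measurable_EFin_driving_density.
  - by move=> x _; rewrite lee_fin driving_density_ge0.
  - by move=> x /=; rewrite !in_itv/= => /andP[].
apply: (@le_trans _ _ (\int[lebesgue_measure]_(x in `[(- (t + 1))%R, (- t)%R]%classic)
   (cst (density_const gamma N * expR (- cost gamma N (t + 1)))%:E x))%E).
  rewrite integral_cst//= lebesgue_measure_itv/= lte_fin ltrN2 ltrDl ltr01.
  by rewrite -EFinD opprK addrA addNr add0r mule1.
apply: ge0_le_integral => //.
- by move=> x _; rewrite lee_fin mulr_ge0 ?density_const_ge0 ?expR_ge0.
- exact: measurable_EFin_driving_density.
- move=> x /=; rewrite in_itv/= => /andP[x1 x2].
  rewrite lee_fin driving_densityE ler_wpM2l ?density_const_ge0// ler_expR lerN2.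
  rewrite /cost ler_wpM2r//.
    by rewrite invr_ge0 mulr_ge0 ?powR_ge0// ltW.
  apply: ge0_ler_powR; rewrite ?nnegrE ?normr_ge0 ?(ltW gamma_gt0)//.
  by rewrite ler0_norm ?ger0_norm; lra.
Qed.
End driving.

(** * Concentration of counts of configurations *)

Lemma card_spins n : #|spins n| = (2 ^ n)%N.
Proof. by rewrite card_ffun card_bool card_ord. Qed.

Section independence.
Local Open Scope ereal_scope.
Context d (T : measurableType d) (R : realType) (P : probability T R)
  (I : finType) (X : I -> {RV P >-> R}).

(** The product rule indexed by a duplicate-free list, which is convenient when
    the number of distinct indices depends on coincidences between them. *)
Lemma mutually_independent_seq (r : seq I) (B : I -> set R) :
  mutually_independent X -> (forall i, measurable (B i)) -> uniq r ->
  P [set w | forall i, i \in r -> B i (X i w)] =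
  \prod_(i <- r) P (X i @^-1` B i).
Proof.
move=> ind mB ur; rewrite (big_uniq _ ur)/=.
rewrite (eq_bigl [in [set i in r]%SET]); last by move=> i; rewrite inE.
rewrite -ind//; congr (P _); apply/seteqP; split => w /= H i ri.
  by apply: H; move: ri; rewrite /= inE.
by apply: H; rewrite /= inE.
Qed.

Lemma mutually_independent_pair (i j : I) (A B : set R) :
  mutually_independent X -> i != j -> measurable A -> measurable B ->
  P (X i @^-1` A `&` X j @^-1` B) = P (X i @^-1` A) * P (X j @^-1` B).
Proof.
move=> ind ij mA mB.
pose C k := if k == i then A else B.
have mC k : measurable (C k) by rewrite /C; case: ifP.
have Ci : C i = A by rewrite /C eqxx.
have Cj : C j = B by rewrite /C eq_sym (negbTE ij).
have := @mutually_independent_seq [:: i; j] C ind mC.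
rewrite !big_cons big_nil mule1 /= inE ij Ci Cj => <- //.
congr (P _); apply/seteqP; split => w /=.
  by move=> [Ai Bj] k; rewrite !inE => /orP[] /eqP ->; rewrite ?Ci ?Cj.
by move=> H; split; rewrite -?Ci -?Cj; apply: H; rewrite !inE eqxx ?orbT.
Qed.
End independence.

Section model.
Local Open Scope ereal_scope.
Context d (T : measurableType d) (R : realType) (P : probability T R)
  (k1 k2 : nat) (X : grem_index k1 k2 -> {RV P >-> R})
  (indX : mutually_independent X).

Definition block_event (B1 B2 : set R) (s : spins k1 * spins k2) : set T :=
  X (inl s.1) @^-1` B1 `&` X (inr s) @^-1` B2.

Lemma measurable_preimage_RV (i : grem_index k1 k2) (B : set R) :
  measurable B -> measurable (X i @^-1` B).
Proof. by move=> mB; rewrite -[_ @^-1` _]setTI; exact: measurable_funP. Qed.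

Lemma measurable_block_event (B1 B2 : set R) s :
  measurable B1 -> measurable B2 -> measurable (block_event B1 B2 s).
Proof. by move=> mB1 mB2; apply: measurableI; exact: measurable_preimage_RV. Qed.

Section overlap.
Context (B1 B2 : set R) (q1 q2 : R) (mB1 : measurable B1) (mB2 : measurable B2)
  (P1 : forall s, P (X (inl s) @^-1` B1) = q1%:E)
  (P2 : forall s, P (X (inr s) @^-1` B2) = q2%:E).

Lemma prob_block_event s : P (block_event B1 B2 s) = (q1 * q2)%:E.
Proof.
by rewrite /block_event mutually_independent_pair// P1 P2.
Qed.

(** Two configurations with distinct first blocks involve four independent
    variables; with a common first block only three, and only two if they
    coincide. Each coincidence adds one term. *)
Lemma prob_block_event_pair s t : (0 <= q1)%R -> (0 <= q2)%R ->
  P (block_event B1 B2 s `&` block_event B1 B2 t) <=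
    ((q1 * q2) ^+ 2 + (s.1 == t.1)%:R * (q1 * q2 ^+ 2) + (s == t)%:R * (q1 * q2))%:E.
Proof.
move=> q10 q20.
pose B (i : grem_index k1 k2) := if i is inl _ then B1 else B2.
have mB i : measurable (B i) by case: i.
pose A := block_event B1 B2 s `&` block_event B1 B2 t.
(* The intersection depends only on the set of the indices involved, which is
   listed without repetition in each of the three cases. *)
have AE (r : seq (grem_index k1 k2)) : uniq r ->
    r =i [:: inl s.1; inl t.1; inr s; inr t] ->
    P A = \prod_(i <- r) P (X i @^-1` B i).
  move=> ur rE; rewrite -(mutually_independent_seq indX mB ur); congr (P _).
  apply/seteqP; split => w.
    move=> [[s1 s2] [t1 t2]] i /=; rewrite rE !inE.
    by move=> /or4P[] /eqP ->.
  move=> /= H; split; split.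
  - by apply: (H (inl s.1)); rewrite rE !inE eqxx.
  - by apply: (H (inr s)); rewrite rE !inE eqxx !orbT.
  - by apply: (H (inl t.1)); rewrite rE !inE eqxx !orbT.
  - by apply: (H (inr t)); rewrite rE !inE eqxx !orbT.
rewrite -/A; have [st|st] := eqVneq s t.
  rewrite (AE [:: inl s.1; inr s])//; last first.
    by move=> u; rewrite -st !inE; case: (u == _); case: (u == _).
  rewrite !big_cons big_nil mule1 P1 P2 -EFinM lee_fin -st eqxx !mul1r.
  by rewrite lerDr addr_ge0// ?mulr_ge0// sqr_ge0.
have [st1|st1] := eqVneq s.1 t.1.
  rewrite (AE [:: inl s.1; inr s; inr t])//; last 2 first.
  - by rewrite /= !inE/= andbT.
  - by move=> u; rewrite -st1 !inE; case: (u == inl _).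
  rewrite !big_cons big_nil mule1 P1 !P2 -!EFinM lee_fin mul1r mul0r addr0.
  by rewrite -expr2 lerDr sqr_ge0.
rewrite (AE [:: inl s.1; inl t.1; inr s; inr t])//; last first.
  by rewrite /= !inE/= !negb_or /= st1 st.
rewrite !big_cons big_nil mule1 !P1 !P2 -!EFinM lee_fin !mul0r !addr0.
by rewrite le_eqVlt; apply/orP; left; apply/eqP; ring.
Qed.

(** The relative variance of the count is the sum of the inverses of the
    expected number of good first blocks and of the expected number of good
    configurations: both have to be large. *)
Lemma block_count_lower_tail : (0 < q1)%R -> (0 < q2)%R ->
  P [set w | (\sum_s \1_(block_event B1 B2 s) w
               <= (2 ^+ (k1 + k2) * (q1 * q2)) / 2)%R] <=
  (4 * ((2 ^+ k1 * q1)^-1 + (2 ^+ (k1 + k2) * (q1 * q2))^-1))%:E.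
Proof.
move=> q10 q20; set m := (2 ^+ (k1 + k2) * (q1 * q2))%R.
have m0 : (0 < m)%R by rewrite !mulr_gt0// exprn_gt0.
have cardE : #|{: spins k1 * spins k2}|%:R = (2 ^+ (k1 + k2))%R :> R.
  by rewrite card_prod !card_spins -expnD natrX.
pose v := (2 ^+ k1 * (2 ^+ k2) ^+ 2 * (q1 * q2 ^+ 2) + m)%R.
rewrite [leRHS](_ : _ = (4 * v / m ^+ 2)%:E); last first.
  congr EFin; rewrite /v /m exprD; field.
  by rewrite !gt_eqF// exprn_gt0.
apply: count_lower_tail => //.
- by move=> s; exact: measurable_block_event.
- under eq_bigr do rewrite prob_block_event.
  rewrite sumEFin; congr EFin.
  by rewrite sumr_const -mulr_natl cardE.
apply: (@le_trans _ _ (\sum_s \sum_t ((q1 * q2) ^+ 2 +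
    (s.1 == t.1)%:R * (q1 * q2 ^+ 2) + (s == t)%:R * (q1 * q2))%:E)).
  by apply: lee_sum => s _; apply: lee_sum => t _; apply: prob_block_event_pair; exact: ltW.
under eq_bigr do rewrite sumEFin.
rewrite sumEFin lee_fin le_eqVlt; apply/orP; left; apply/eqP.
under eq_bigr.
  move=> s _; rewrite !big_split/= sumr_const -mulr_natl cardE -!mulr_suml.
  rewrite (_ : (\sum_t (s.1 == t.1)%:R = 2 ^+ k2)%R); last first.
    rewrite -(pair_big xpredT xpredT (fun x y => (s.1 == x)%:R))/=.
    rewrite (bigD1 s.1)//= eqxx sumr_const card_spins natrX big1 ?addr0// => x xs.
    by rewrite big1// => y _; rewrite eq_sym (negbTE xs).
  rewrite (_ : (\sum_t (s == t)%:R = 1)%R); last first.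
    rewrite (bigD1 s)//= eqxx big1 ?addr0// => x xs.
    by rewrite eq_sym (negbTE xs).
  over.
rewrite sumr_const -[LHS]mulr_natl cardE /v /m exprD; ring.
Qed.
End overlap.
End model.

(** * Exponential moments of the costs *)

Section tilted_sums.
Context d (T : measurableType d) (R : realType) (P : probability T R)
  (gamma : R) (N k1 k2 : nat) (X : grem_index k1 k2 -> {RV P >-> R})
  (X2 : {RV P >-> R}).

(** The exponent of the density ratio used in [cost_tilt]; it is
    [tilt_rate gamma N] times the cost. *)
Definition tilted_cost (gamma : R) (N : nat) (x : R) : R := cost gamma N x - cost gamma 2 x.

(** The exponential moment of the tilted cost, by [cost_tilt]. *)
Definition tilt_const (gamma : R) (N : nat) : R := (N%:R / 2) `^ ((1 - gamma) / gamma).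

Definition tilted_sum1 (xi : grem_index k1 k2 -> R) : R :=
  \sum_(s1 : spins k1) expR (tilted_cost gamma N (xi (inl s1))).

Definition tilted_sum (xi : grem_index k1 k2 -> R) : R :=
  \sum_(s : spins k1 * spins k2)
    expR (tilted_cost gamma N (xi (inl s.1)) + tilted_cost gamma N (xi (inr s))).

Context (gamma_gt0 : 0 < gamma) (N_gt0 : (0 < N)%N) (indX : mutually_independent X)
  (denX : forall i, has_density (X i) (driving_density N gamma))
  (denX2 : has_density X2 (driving_density 2 gamma)).

Lemma measurable_tilted_cost (i : grem_index k1 k2) :
  measurable_fun setT (fun w => tilted_cost gamma N (X i w)).
Proof.
by apply: measurable_funB; apply: measurableT_comp => //; exact: measurable_cost.
Qed.

Lemma measurable_tilted_sum1 :
  measurable_fun setT (fun w => tilted_sum1 (fun i => X i w)).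
Proof.
apply: measurable_sum => s1; apply: measurableT_comp => //.
exact: measurable_tilted_cost.
Qed.

Lemma measurable_tilted_sum :
  measurable_fun setT (fun w => tilted_sum (fun i => X i w)).
Proof.
apply: measurable_sum => s; apply: measurableT_comp => //.
apply: measurable_funD; exact: measurable_tilted_cost.
Qed.

Lemma integral_tilted_sum1 :
  (\int[P]_w (tilted_sum1 (fun i => X i w))%:E
   = (2 ^+ k1 * tilt_const gamma N)%:E)%E.
Proof.
under eq_integral do rewrite /tilted_sum1 -sumEFin.
rewrite ge0_integral_sum//; last first.
  move=> s1; apply/measurable_EFinP; apply: measurableT_comp => //.
  exact: measurable_tilted_cost.
under eq_bigr => s1 _ do rewrite (cost_tilt gamma_gt0 N_gt0 (denX (inl s1)) denX2).
by rewrite sumEFin; congr EFin; rewrite sumr_const -[LHS]mulr_natl card_spins natrX.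
Qed.

(** The two variables of one configuration are independent, so each term
    contributes the square of the moment of a single variable. *)
Lemma integral_tilted_sum :
  (\int[P]_w (tilted_sum (fun i => X i w))%:E
   = (2 ^+ (k1 + k2) * tilt_const gamma N ^+ 2)%:E)%E.
Proof.
under eq_integral do rewrite /tilted_sum -sumEFin.
rewrite ge0_integral_sum//; last first.
  move=> s; apply/measurable_EFinP; apply: measurableT_comp => //.
  apply: measurable_funD; exact: measurable_tilted_cost.
have mg : measurable_fun setT (fun x => (expR (tilted_cost gamma N x))%:E).
  apply/measurable_EFinP; apply: measurableT_comp => //.
  by apply: measurable_funB; exact: measurable_cost.
have g0 x : (0 <= (expR (tilted_cost gamma N x))%:E)%E by rewrite lee_fin expR_ge0.
under eq_bigr.
  move=> s _; under eq_integral do rewrite expRD EFinM.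
  rewrite (ge0_integral_indep_mul _ mg mg g0 g0); last first.
    by move=> A B mA mB; exact: mutually_independent_pair.
  rewrite (cost_tilt gamma_gt0 N_gt0 (denX (inl s.1)) denX2).
  rewrite (cost_tilt gamma_gt0 N_gt0 (denX (inr s)) denX2).
  rewrite -EFinM -expr2.
  over.
rewrite sumEFin; congr EFin; rewrite sumr_const -[LHS]mulr_natl.
by rewrite card_prod !card_spins -expnD natrX.
Qed.

Lemma tilt_const_gt0 : 0 < tilt_const gamma N.
Proof. by rewrite powR_gt0// divr_gt0// ltr0n. Qed.

Lemma tilted_sum1_tail (n : R) : 0 < n ->
  (P [set w | (n * (2 ^+ k1 * tilt_const gamma N)
                 <= tilted_sum1 (fun i => X i w))%R] <= (n^-1)%:E)%E.
Proof.
move=> n0; apply: markov_tail => //.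
- exact: measurable_tilted_sum1.
- by move=> w; apply: sumr_ge0 => s1 _; exact: expR_ge0.
- by rewrite mulr_gt0 ?tilt_const_gt0// exprn_gt0.
- by rewrite integral_tilted_sum1.
Qed.

Lemma tilted_sum_tail (n : R) : 0 < n ->
  (P [set w | (n * (2 ^+ (k1 + k2) * tilt_const gamma N ^+ 2)
                 <= tilted_sum (fun i => X i w))%R] <= (n^-1)%:E)%E.
Proof.
move=> n0; apply: markov_tail => //.
- exact: measurable_tilted_sum.
- by move=> w; apply: sumr_ge0 => s _; exact: expR_ge0.
- by rewrite mulr_gt0 ?exprn_gt0 ?tilt_const_gt0.
- by rewrite integral_tilted_sum.
Qed.
End tilted_sums.

(** * Convexity on the polygon of costs *)

Section vertices.
Context (R : realType).

(** Exponential growth rate, less ln 2, of the contribution to the partition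
    function of the configurations with costs [u1] and [u2] per unit of N,
    where g = 1/gamma and c_i = beta a_i gamma^(1/gamma). *)
Definition vertex_value (g c1 c2 u1 u2 : R) : R := c1 * u1 `^ g + c2 * u2 `^ g - u1 - u2.

(** Maximum over the vertices of the polygon 0 <= u1 <= b1, 0 <= u2,
    u1 + u2 <= b. *)
Definition vertex_max (g c1 c2 b1 b : R) : R :=
  Num.max (Num.max (vertex_value g c1 c2 0 0) (vertex_value g c1 c2 b1 0))
          (Num.max (vertex_value g c1 c2 b1 (b - b1)) (vertex_value g c1 c2 0 b)).

Lemma powR_chord (g t x y : R) : 1 <= g -> 0 <= t <= 1 -> 0 <= x -> 0 <= y ->
  (t * x + (1 - t) * y) `^ g <= t * x `^ g + (1 - t) * y `^ g.
Proof.
move=> g1 /andP[t0 t1] x0 y0.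
have t01 : Itv.spec (@Itv.num_sem R) (Itv.Real `[0%Z, 1%Z]) t.
  by apply/and3P; split => //=; exact: ger0_real.
have := @convex_powR R g g1 (Itv.mk t01) x y.
rewrite !inE /= !in_itv/= !andbT => /(_ x0 y0).
by rewrite !convRE.
Qed.

(** The function is convex since g >= 1. It is first bounded along the segment
    of constant [u1] by its values at u2 = 0 and u2 = b - u1, then along each of
    those two edges by its values at the corners. *)
Lemma vertex_value_le_max (g c1 c2 b1 b u1 u2 : R) :
  1 <= g -> 0 <= c1 -> 0 <= c2 -> b1 <= b ->
  0 <= u1 -> u1 <= b1 -> 0 <= u2 -> u1 + u2 <= b ->
  vertex_value g c1 c2 u1 u2 <= vertex_max g c1 c2 b1 b.
Proof.
move=> g1 c10 c20 b1b u10 u1b1 u20 u12.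
have segment (x y : R) : 0 <= x -> x <= y -> exists2 t, 0 <= t <= 1 & x = t * y.
  move=> x0 xy; have [y0|y0] := eqVneq y 0.
    by exists 0; [rewrite lexx ler01|lra].
  have y1 : 0 < y by rewrite lt_neqAle eq_sym y0; lra.
  exists (x / y); last by rewrite divfK.
  by rewrite divr_ge0 ?(ltW y1)//= ler_pdivrMr// mul1r.
have average (t x y m : R) : 0 <= t <= 1 -> x <= m -> y <= m -> t * x + (1 - t) * y <= m.
  by nra.
(* The point (u1, u2) is located by t along the range of u1 and by s along
   the vertical segment above u1. *)
have [t t01 u1E] := segment _ _ u10 u1b1.
have [|s s01 u2E] := segment u2 (b - u1) u20; first by lra.
have b10 : 0 <= b1 by lra.
have u2g : u2 `^ g <= s * (b - u1) `^ g + (1 - s) * 0 `^ g.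
  rewrite (_ : u2 = s * (b - u1) + (1 - s) * 0); last by rewrite mulr0 addr0.
  by apply: powR_chord => //; lra.
have u1g : u1 `^ g <= t * b1 `^ g + (1 - t) * 0 `^ g.
  rewrite (_ : u1 = t * b1 + (1 - t) * 0); last by rewrite mulr0 addr0.
  exact: powR_chord.
have bg : (b - u1) `^ g <= t * (b - b1) `^ g + (1 - t) * b `^ g.
  rewrite (_ : b - u1 = t * (b - b1) + (1 - t) * b); last by rewrite u1E; ring.
  by apply: powR_chord => //; lra.
apply: (@le_trans _ _ (s * vertex_value g c1 c2 u1 (b - u1)
    + (1 - s) * vertex_value g c1 c2 u1 0)).
  rewrite /vertex_value.
  have := ler_wpM2l c20 u2g; lra.
apply: (average) => //.
- apply: (@le_trans _ _ (t * vertex_value g c1 c2 b1 (b - b1)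
    + (1 - t) * vertex_value g c1 c2 0 b)).
    rewrite /vertex_value.
    have := ler_wpM2l c20 bg; have := ler_wpM2l c10 u1g; lra.
  by apply: (average) => //; rewrite /vertex_max !le_max lexx ?orbT.
- apply: (@le_trans _ _ (t * vertex_value g c1 c2 b1 0
    + (1 - t) * vertex_value g c1 c2 0 0)).
    rewrite /vertex_value.
    have := ler_wpM2l c10 u1g; lra.
  by apply: (average) => //; rewrite /vertex_max !le_max lexx ?orbT.
Qed.
End vertices.

(** * Pathwise bounds on the partition function *)

Section pathwise.
Context (R : realType) (gamma : R) (gamma_gt0 : 0 < gamma) (gamma_lt1 : gamma < 1)
  (N : nat).

(** Ratio of the tilted cost to the cost. *)
Definition tilt_rate (gamma : R) (N : nat) : R := 1 - (2 / N%:R) `^ (1 - gamma).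

Lemma cost_ge0 (x : R) : 0 <= cost gamma N x.
Proof. by rewrite divr_ge0 ?powR_ge0// mulr_ge0 ?powR_ge0// ltW. Qed.

Lemma costE (x : R) : (0 < N)%N ->
  cost gamma N x = `|x| `^ gamma * N%:R `^ (1 - gamma) / gamma.
Proof.
move=> N0; rewrite /cost -(opprB 1 gamma) powRN invfM invrK; ring.
Qed.

(** Inverse of the cost function on each half-line, in the scaling where
    costs are of order N. *)
Lemma norm_cost (x : R) : (0 < N)%N ->
  `|x| = N%:R * (gamma * (cost gamma N x / N%:R)) `^ (1 / gamma).
Proof.
move=> N0; have N0' : 0 < N%:R :> R by rewrite ltr0n.
have -> : gamma * (cost gamma N x / N%:R) = (`|x| / N%:R) `^ gamma.
  rewrite costE// powRB ?gt_eqF ?implybT// powRr1 ?ler0n//.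
  rewrite powRM ?invr_ge0 ?ler0n// powR_invr//; field.
  by rewrite !gt_eqF// powR_gt0.
rewrite -powRrM mul1r mulfV ?gt_eqF// powRr1 ?divr_ge0// mulrC divfK//.
by rewrite gt_eqF.
Qed.

Lemma tilted_costE (x : R) : (0 < N)%N ->
  tilted_cost gamma N x = tilt_rate gamma N * cost gamma N x.
Proof.
move=> N0; have N0' : 0 < N%:R :> R by rewrite ltr0n.
rewrite /tilted_cost /tilt_rate mulrBl mul1r; congr (_ - _).
rewrite costE// /cost -(opprB 1 gamma) powRN invfM invrK.
rewrite powRM ?invr_ge0 ?ler0n// powR_invr//.
by field; rewrite !gt_eqF// powR_gt0.
Qed.

Lemma tilt_rate_gt0 : (2 < N)%N -> 0 < tilt_rate gamma N.
Proof.
move=> N2; have N0 : 0 < N%:R :> R by rewrite ltr0n (ltn_trans _ N2).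
rewrite subr_gt0; apply: (@lt_le_trans _ _ (1 `^ (1 - gamma))); last by rewrite powR1.
apply: gt0_ltr_powR; rewrite ?nnegrE ?divr_ge0 ?ler01 ?subr_gt0//.
by rewrite ltr_pdivrMr// mul1r ltr_nat.
Qed.

Section configuration.
Context (k1 k2 : nat) (xi : grem_index k1 k2 -> R) (a1 a2 beta : R)
  (a1_ge0 : 0 <= a1) (a2_ge0 : 0 <= a2) (beta_ge0 : 0 <= beta).

Lemma partition_function_gt0 : 0 < partition_function a1 a2 xi beta.
Proof.
rewrite /partition_function (bigD1 ([ffun=> true], [ffun=> true]))//=.
by rewrite ltr_wpDr ?expR_gt0// sumr_ge0// => s _; exact: expR_ge0.
Qed.

(** Each term of a tilted sum is below the sum, which bounds the tilted costs
    by [ln A] and [ln B]: they lie in the polygon, and [vertex_value_le_max]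
    bounds the Gibbs weight by exp(N vertex_max) times the tilted term. Dividing
    gamma by [tilt_rate gamma N] compensates for measuring energies by tilted
    costs. *)
Lemma ln_partition_function_le (A B : R) : (2 < N)%N -> A <= B ->
  tilted_sum1 gamma N xi <= A -> tilted_sum gamma N xi <= B ->
  1 / N%:R * ln (partition_function a1 a2 xi beta) <=
  ln B / N%:R + vertex_max (1 / gamma)
    (beta * a1 * (gamma / tilt_rate gamma N) `^ (1 / gamma))
    (beta * a2 * (gamma / tilt_rate gamma N) `^ (1 / gamma))
    (ln A / N%:R) (ln B / N%:R).
Proof.
move=> N2 AB sumA sumB; set M := vertex_max _ _ _ _ _.
have N0 : (0 < N)%N by rewrite (ltn_trans _ N2).
have N0' : 0 < N%:R :> R by rewrite ltr0n.
have rate0 := tilt_rate_gt0 N2.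
set theta := tilt_rate gamma N in rate0 M *.
have tc0 x : 0 <= tilted_cost gamma N x.
  by rewrite tilted_costE// mulr_ge0 ?cost_ge0// ltW.
have A0 : 0 < A.
  apply: lt_le_trans sumA; rewrite /tilted_sum1 (bigD1 [ffun=> true])//=.
  by rewrite ltr_wpDr ?expR_gt0// sumr_ge0// => s _; exact: expR_ge0.
have B0 : 0 < B by exact: lt_le_trans AB.
have term s : - beta * hamiltonian a1 a2 xi s <= N%:R * M +
    (tilted_cost gamma N (xi (inl s.1)) + tilted_cost gamma N (xi (inr s))).
  set x1 := xi (inl s.1); set x2 := xi (inr s).
  pose u x := tilted_cost gamma N x / N%:R.
  (* The tilted costs per unit of N lie in the polygon with sides ln A / N
     and ln B / N. *)
  have uA : u x1 <= ln A / N%:R.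
    rewrite ler_pM2r ?invr_gt0// -ler_expR lnK ?posrE//.
    apply: le_trans sumA; rewrite /tilted_sum1 (bigD1 s.1)//= lerDl.
    by rewrite sumr_ge0// => i _; exact: expR_ge0.
  have uB : u x1 + u x2 <= ln B / N%:R.
    rewrite -mulrDl ler_pM2r ?invr_gt0// -ler_expR lnK ?posrE//.
    apply: le_trans sumB; rewrite /tilted_sum (bigD1 s)//= lerDl.
    by rewrite sumr_ge0// => i _; exact: expR_ge0.
  (* The modulus of a variable in terms of its tilted cost. *)
  have normE x : `|x| = N%:R * ((gamma / theta) `^ (1 / gamma) * u x `^ (1 / gamma)).
    rewrite -powRM; last 2 first.
    - by rewrite divr_ge0 ?ltW.
    - by rewrite divr_ge0.
    rewrite [LHS]norm_cost//; congr (_ * _ `^ _).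
    by rewrite /u tilted_costE// -/theta; field; rewrite !gt_eqF.
  have : vertex_value (1 / gamma) (beta * a1 * (gamma / theta) `^ (1 / gamma))
      (beta * a2 * (gamma / theta) `^ (1 / gamma)) (u x1) (u x2) <= M.
    apply: vertex_value_le_max => //.
    - by rewrite ler_pdivlMr// mul1r ltW.
    - by rewrite !mulr_ge0 ?powR_ge0.
    - by rewrite !mulr_ge0 ?powR_ge0.
    - by rewrite ler_pM2r ?invr_gt0// ler_ln ?posrE.
    - by rewrite divr_ge0.
    - by rewrite divr_ge0.
  rewrite /vertex_value => /(ler_wpM2l (ler0n R N)).
  have : - beta * hamiltonian a1 a2 xi s <= beta * (a1 * `|x1| + a2 * `|x2|).
    rewrite mulNr -mulrN ler_wpM2l// /hamiltonian -/x1 -/x2.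
    have := ler_wpM2l a1_ge0 (ler_norm (- x1)).
    have := ler_wpM2l a2_ge0 (ler_norm (- x2)).
    rewrite !normrN; lra.
  rewrite (normE x1) (normE x2).
  have Nu x : N%:R * u x = tilted_cost gamma N x by rewrite mulrC divfK// gt_eqF.
  rewrite -!Nu => hH hM; apply: (le_trans hH).
  apply: (le_trans _ (lerD hM (lexx (N%:R * u x1 + N%:R * u x2)))).
  rewrite le_eqVlt; apply/orP; left; apply/eqP.
  move: (u x1) (u x2) (u x1 `^ _) (u x2 `^ _) (_ `^ _) => v1 v2 y1 y2 G.
  by ring.
have ZB : partition_function a1 a2 xi beta <= expR (N%:R * M) * B.
  apply: (@le_trans _ _ (expR (N%:R * M) * tilted_sum gamma N xi)).
    rewrite mulr_sumr ler_sum// => s _.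
    by rewrite -expRD ler_expR.
  by rewrite ler_pM2l ?expR_gt0.
rewrite (_ : ln B / N%:R + M = 1 / N%:R * ln (expR (N%:R * M) * B)).
  by rewrite ler_pM2l ?divr_gt0// ler_ln ?posrE ?partition_function_gt0 ?mulr_gt0 ?expR_gt0.
rewrite lnM ?posrE ?expR_gt0// expRK; field.
by rewrite gt_eqF.
Qed.

Lemma partition_function_ge (t1 t2 m : R) :
  m <= \sum_(s : spins k1 * spins k2)
    ((xi (inl s.1) <= - t1) && (xi (inr s) <= - t2))%:R ->
  m * expR (beta * (a1 * t1 + a2 * t2)) <= partition_function a1 a2 xi beta.
Proof.
move=> hm; apply: (@le_trans _ _ ((\sum_(s : spins k1 * spins k2)
    ((xi (inl s.1) <= - t1) && (xi (inr s) <= - t2))%:R) *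
    expR (beta * (a1 * t1 + a2 * t2)))).
  by rewrite ler_wpM2r// expR_ge0.
rewrite mulr_suml ler_sum// => s _; case: andP => [[x1 x2]|_].
  rewrite mul1r ler_expR mulNr -mulrN ler_wpM2l// /hamiltonian.
  have := ler_wpM2l a1_ge0 x1; have := ler_wpM2l a2_ge0 x2; lra.
by rewrite mul0r expR_ge0.
Qed.
End configuration.
End pathwise.

(** * Limits of the error terms and of the bounds *)

Lemma cvg_eq_from (R : realType) (m : nat) (u v : nat -> R) (l : R) :
  (forall n, (m <= n)%N -> u n = v n) -> v n @[n --> \oo] --> l ->
  u n @[n --> \oo] --> l.
Proof.
move=> uv; apply: cvg_trans; apply: near_eq_cvg.
by exists m => // n /= mn; rewrite uv.
Qed.

(** The limit 0 has to be allowed, since the second block may have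
    vanishing proportion; the logarithm is of no use there and
    monotonicity replaces it. *)
Lemma cvg_powR (R : realType) (u : nat -> R) (a g : R) : 0 < g ->
  (\forall n \near \oo, 0 <= u n) -> u n @[n --> \oo] --> a ->
  u n `^ g @[n --> \oo] --> a `^ g.
Proof.
move=> g0 u0 ua.
have a0 : 0 <= a by apply: (cvgr_to_ge ua u0).
have [a_eq0|a_neq0] := eqVneq a 0.
  rewrite a_eq0 powR0 ?gt_eqF//; apply/cvgrPdist_le => e e0.
  have e1 : 0 < e `^ (1 / g) by rewrite powR_gt0.
  move: ua; rewrite a_eq0 => /cvgrPdist_le /(_ _ e1) ua.
  near=> n.
  have un0 : 0 <= u n by near: n.
  have : `|0 - u n| <= e `^ (1 / g) by near: n.
  rewrite !sub0r !normrN !ger0_norm ?powR_ge0// => un.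
  have -> : e = (e `^ (1 / g)) `^ g by rewrite -powRrM mul1r mulVf ?gt_eqF// powRr1// ltW.
  by apply: ge0_ler_powR; rewrite ?nnegrE ?powR_ge0 ?(ltW g0).
have a1 : 0 < a by rewrite lt_neqAle eq_sym a_neq0.
have uE : \forall n \near \oo, expR (g * ln (u n)) = u n `^ g.
  have ugt0 := cvgr_gt a ua 0 a1.
  near=> n; rewrite /powR gt_eqF//; near: n; exact: ugt0.
rewrite {2}/powR (negbTE a_neq0).
apply: cvg_trans; first exact: (near_eq_cvg uE).
apply: continuous_cvg; first exact: continuous_expR.
apply: cvgMr; apply: continuous_cvg => //; exact: continuous_ln.
Unshelve. all: by end_near. Qed.

Section limits.
Context (R : realType) (gamma : R) (gamma_gt0 : 0 < gamma) (gamma_lt1 : gamma < 1).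

Lemma cvg_natr_inv : (n%:R^-1 : R) @[n --> \oo] --> (0 : R).
Proof. by rewrite -cvg_shiftS; exact: cvg_harmonic. Qed.

Lemma cvg_natr_powRN (s : R) : 0 < s -> ((n%:R^-1) `^ s : R) @[n --> \oo] --> (0 : R).
Proof.
move=> s0; have := @cvg_powR R (fun n => n%:R^-1) 0 s s0.
rewrite powR0 ?gt_eqF//; apply; first by apply: nearW => n; rewrite invr_ge0.
exact: cvg_natr_inv.
Qed.

Lemma natr_powR_div (n : nat) : (0 < n)%N ->
  n%:R `^ (1 - gamma) / n%:R = (n%:R^-1 : R) `^ gamma.
Proof.
move=> n0; have n0' : 0 < n%:R :> R by rewrite ltr0n.
rewrite powRB ?gt_eqF ?implybT// powRr1// powR_invr//.
by rewrite mulrAC mulfV ?mul1r// gt_eqF.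
Qed.

Lemma cvg_natr_powR_div : (n%:R `^ (1 - gamma) / n%:R : R) @[n --> \oo] --> (0 : R).
Proof.
apply: (cvg_eq_from (m := 1) (v := fun n => n%:R^-1 `^ gamma)); first exact: natr_powR_div.
exact: cvg_natr_powRN.
Qed.

Lemma cvg_ln_div : (ln n%:R / n%:R : R) @[n --> \oo] --> (0 : R).
Proof.
have g1 : 0 < 1 - gamma by rewrite subr_gt0.
apply: (@squeeze_cvgr _ _ _ _ (fun=> 0)
  (fun n => (1 - gamma)^-1 * (n%:R `^ (1 - gamma) / n%:R))).
- exists 1%N => // n /= n1; have n0 : 0 < n%:R :> R by rewrite ltr0n.
  rewrite divr_ge0 ?ln_ge0 ?ler1n//= mulrA ler_pM2r ?invr_gt0//.
  rewrite ler_pdivlMl// -ln_powR.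
  by rewrite ltW// ln_sublinear// powR_gt0.
- exact: cvg_cst.
- by rewrite -(mulr0 (1 - gamma)^-1); apply: cvgMr; exact: cvg_natr_powR_div.
Qed.

Lemma cvg_tilt_rate : tilt_rate gamma n @[n --> \oo] --> (1 : R).
Proof.
have g1 : 0 < 1 - gamma by rewrite subr_gt0.
rewrite -[X in _ --> X]subr0; apply: cvgB; first exact: cvg_cst.
rewrite -[X in _ --> X](@powR0 R (1 - gamma)) ?gt_eqF//.
apply: cvg_powR => //; first by apply: nearW => n; rewrite divr_ge0.
by rewrite -(mulr0 2); apply: cvgMr; exact: cvg_natr_inv.
Qed.
End limits.

Lemma cvg_max (R : realType) (u v : nat -> R) (a b : R) :
  u n @[n --> \oo] --> a -> v n @[n --> \oo] --> b ->
  Num.max (u n) (v n) @[n --> \oo] --> Num.max a b.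
Proof.
move=> ua vb; rewrite maxr_absE; under eq_fun do rewrite maxr_absE.
apply: cvgMl; apply: cvgD; first exact: cvgD.
by apply: cvg_norm; exact: cvgB.
Qed.

Section exponents.
Context (R : realType) (gamma : R) (gamma_gt0 : 0 < gamma) (gamma_lt1 : gamma < 1)
  (p1 p2 : R) (k1 k2 : nat -> nat)
  (k1k2 : forall N, (2 <= N)%N -> (k1 N + k2 N)%N = N)
  (k1_cvg : (k1 N)%:R / N%:R @[N --> \oo] --> p1)
  (p1_gt0 : 0 < p1).

Local Notation L := (ln (2 : R)).
Local Notation g := (1 / gamma).

(** N^2 times the mean of the tilted sum over the first blocks. *)
Definition tilt_bound1 (N : nat) : R := N%:R ^+ 2 * (2 ^+ k1 N * tilt_const gamma N).
(** N^2 times the mean of the tilted sum over all configurations. *)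
Definition tilt_bound (N : nat) : R :=
  N%:R ^+ 2 * (2 ^+ (k1 N + k2 N) * tilt_const gamma N ^+ 2).

(** The slack between a prescribed cost and the entropy: it absorbs the loss of
    [lower_tail], the constant [c] of the density, and a factor N^2 that makes
    the exceptional probabilities summable. *)
Definition rate_error (c : R) (N : nat) : R :=
  N%:R `^ (1 - gamma) / gamma - ln c + 2 * ln N%:R.

Lemma ln_tilt_bound1 N : (0 < N)%N -> ln (tilt_bound1 N) =
  2 * ln N%:R + ((k1 N)%:R * L + (1 - gamma) / gamma * (ln N%:R - L)).
Proof.
move=> N0; have N0' : 0 < N%:R :> R by rewrite ltr0n.
rewrite /tilt_bound1 /tilt_const lnM ?posrE ?mulr_gt0 ?exprn_gt0 ?powR_gt0 ?divr_gt0//.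
rewrite lnM ?posrE ?mulr_gt0 ?exprn_gt0 ?powR_gt0 ?divr_gt0//.
by rewrite !lnXn// ln_powR ln_div ?posrE// !mulr_natl.
Qed.

Lemma ln_tilt_bound N : (0 < N)%N -> ln (tilt_bound N) =
  2 * ln N%:R + ((k1 N + k2 N)%:R * L + 2 * ((1 - gamma) / gamma * (ln N%:R - L))).
Proof.
move=> N0; have N0' : 0 < N%:R :> R by rewrite ltr0n.
rewrite /tilt_bound /tilt_const lnM ?posrE ?mulr_gt0 ?exprn_gt0 ?powR_gt0 ?divr_gt0//.
rewrite lnM ?posrE ?mulr_gt0 ?exprn_gt0 ?powR_gt0 ?divr_gt0//.
rewrite !lnXn ?powR_gt0 ?divr_gt0// ln_powR ln_div ?posrE//.
rewrite -[in LHS](mulr_natl (ln 2)). ring.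
Qed.

Lemma cvg_ln_tilt_bound1 : ln (tilt_bound1 N) / N%:R @[N --> \oo] --> p1 * L.
Proof.
apply: (cvg_eq_from (m := 1) (v := fun N => 2 * (ln N%:R / N%:R) + ((k1 N)%:R / N%:R * L
   + (1 - gamma) / gamma * (ln N%:R / N%:R - L * N%:R^-1)))).
  by move=> N N0; rewrite ln_tilt_bound1//; ring.
rewrite (_ : p1 * L = 2 * 0 + (p1 * L + (1 - gamma) / gamma * (0 - L * 0))); last by ring.
have cl := cvg_ln_div gamma_gt0 gamma_lt1.
apply: cvgD; first exact: cvgMr.
apply: cvgD; first exact: cvgMl.
apply: cvgMr; apply: cvgB => //.
by apply: cvgMr; exact: cvg_natr_inv.
Qed.

Lemma cvg_ln_tilt_bound : ln (tilt_bound N) / N%:R @[N --> \oo] --> L.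
Proof.
have cl := cvg_ln_div gamma_gt0 gamma_lt1.
apply: (cvg_eq_from (m := 2) (v := fun N => 2 * (ln N%:R / N%:R) + (L
   + 2 * ((1 - gamma) / gamma * (ln N%:R / N%:R - L * N%:R^-1))))).
  move=> N N2; have N0 : (0 < N)%N by rewrite (leq_trans _ N2).
  rewrite ln_tilt_bound// (k1k2 N2); field.
  by rewrite !gt_eqF ?ltr0n.
rewrite [X in _ --> X](_ : L = 2 * 0 + (L + 2 * ((1 - gamma) / gamma * (0 - L * 0)))); last by ring.
apply: cvgD; first exact: cvgMr.
apply: cvgD; first exact: cvg_cst.
do 2 apply: cvgMr; apply: cvgB => //.
by apply: cvgMr; exact: cvg_natr_inv.
Qed.

Lemma cvg_rate_error (c : R) : rate_error c N / N%:R @[N --> \oo] --> (0 : R).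
Proof.
have cl := cvg_ln_div gamma_gt0 gamma_lt1.
apply: (cvg_eq_from (m := 0) (v := fun N => gamma^-1 * (N%:R `^ (1 - gamma) / N%:R)
    - ln c * N%:R^-1 + 2 * (ln N%:R / N%:R))).
  by move=> N _; rewrite /rate_error; ring.
have : (fun N => gamma^-1 * (N%:R `^ (1 - gamma) / N%:R)
    - ln c * N%:R^-1 + 2 * (ln N%:R / N%:R)) @ \oo
    --> gamma^-1 * 0 - ln c * 0 + 2 * 0.
  apply: cvgD; last exact: cvgMr.
  apply: cvgB; apply: cvgMr; first exact: cvg_natr_powR_div.
  exact: cvg_natr_inv.
by rewrite !mulr0 subrr addr0.
Qed.

Lemma cvg_vertex_value (c1 c2 u1 u2 : nat -> R) (d1 d2 l1 l2 : R) :
  c1 N @[N --> \oo] --> d1 -> c2 N @[N --> \oo] --> d2 ->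
  (\forall N \near \oo, 0 <= u1 N) -> (\forall N \near \oo, 0 <= u2 N) ->
  u1 N @[N --> \oo] --> l1 -> u2 N @[N --> \oo] --> l2 ->
  vertex_value g (c1 N) (c2 N) (u1 N) (u2 N) @[N --> \oo]
    --> vertex_value g d1 d2 l1 l2.
Proof.
move=> cd1 cd2 u10 u20 ul1 ul2.
have g0 : 0 < g by rewrite divr_gt0.
apply: cvgB => //; apply: cvgB => //; apply: cvgD.
- by apply: cvgM => //; exact: cvg_powR.
- by apply: cvgM => //; exact: cvg_powR.
Qed.

Lemma tilt_const_ge1 N : (2 <= N)%N -> 1 <= tilt_const gamma N.
Proof.
move=> N2; rewrite /tilt_const -[leLHS](powRr0 (N%:R / 2)) ler_powR//.
  by rewrite ler_pdivlMr// mul1r ler_nat.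
by rewrite divr_ge0 ?subr_ge0 ?(ltW gamma_gt0) ?(ltW gamma_lt1).
Qed.

Lemma tilt_bound1_ge1 N : (2 <= N)%N -> 1 <= tilt_bound1 N.
Proof.
move=> N2; rewrite /tilt_bound1.
have a1 : 1 <= N%:R ^+ 2 :> R by rewrite exprn_ege1// ler1n (leq_trans _ N2).
have a2 : 1 <= 2 ^+ k1 N :> R by rewrite exprn_ege1// ler1n.
have a3 := tilt_const_ge1 N2.
by rewrite mulr_ege1// mulr_ege1.
Qed.

Lemma tilt_bound1_le N : (2 <= N)%N -> tilt_bound1 N <= tilt_bound N.
Proof.
move=> N2; rewrite /tilt_bound1 /tilt_bound ler_wpM2l ?exprn_ge0//.
have a3 := tilt_const_ge1 N2; have a4 : 0 <= tilt_const gamma N by lra.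
apply: ler_pM => //.
  by rewrite ler_weXn2l ?ler1n// leq_addr.
by rewrite expr2 ler_peMr.
Qed.

Lemma cvg_upper_bound (beta a1 a2 : R) :
  ln (tilt_bound N) / N%:R + vertex_max g
    (beta * a1 * (gamma / tilt_rate gamma N) `^ g)
    (beta * a2 * (gamma / tilt_rate gamma N) `^ g)
    (ln (tilt_bound1 N) / N%:R) (ln (tilt_bound N) / N%:R) @[N --> \oo] -->
  L + vertex_max g (beta * a1 * gamma `^ g) (beta * a2 * gamma `^ g) (p1 * L) L.
Proof.
have g0 : 0 < g by rewrite divr_gt0.
have crate : (gamma / tilt_rate gamma N) `^ g @[N --> \oo] --> gamma `^ g.
  apply: cvg_powR => //.
    exists 3%N => // N /= N3; rewrite divr_ge0 ?(ltW gamma_gt0)//.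
    exact/ltW/tilt_rate_gt0.
  rewrite -[X in _ --> X]divr1; apply: cvgMr; apply: cvgV => //.
  exact: cvg_tilt_rate.
have c1 a : beta * a * (gamma / tilt_rate gamma N) `^ g @[N --> \oo]
    --> beta * a * gamma `^ g by exact: cvgMr.
have b1 := cvg_ln_tilt_bound1; have b := cvg_ln_tilt_bound.
have b10 : \forall N \near \oo, 0 <= ln (tilt_bound1 N) / N%:R.
  by exists 2%N => // N /= N2; rewrite divr_ge0// ln_ge0// tilt_bound1_ge1.
have b1b : \forall N \near \oo, 0 <= ln (tilt_bound N) / N%:R - ln (tilt_bound1 N) / N%:R.
  exists 2%N => // N /= N2; rewrite -mulrBl divr_ge0// subr_ge0 ler_ln ?posrE.
  - exact: tilt_bound1_le.
  - exact: lt_le_trans (tilt_bound1_ge1 N2).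
  - exact: lt_le_trans (le_trans (tilt_bound1_ge1 N2) (tilt_bound1_le N2)).
have b0 : \forall N \near \oo, 0 <= ln (tilt_bound N) / N%:R.
  exists 2%N => // N /= N2; rewrite divr_ge0// ln_ge0//.
  exact: le_trans (tilt_bound1_ge1 N2) (tilt_bound1_le N2).
have z0 : \forall N \near \oo, 0 <= (fun=> 0 : R) N by exact: nearW.
have cz : (fun=> 0 : R) N @[N --> \oo] --> (0 : R) by exact: cvg_cst.
apply: cvgD => //; apply: cvg_max; apply: cvg_max; apply: cvg_vertex_value => //.
exact: cvgB.
Qed.

Lemma cvg_lower_bound (beta a1 a2 c l1 l2 : R) (v1 v2 : nat -> R) :
  (\forall N \near \oo, 0 <= v1 N) -> (\forall N \near \oo, 0 <= v2 N) ->
  v1 N / N%:R @[N --> \oo] --> l1 -> v2 N / N%:R @[N --> \oo] --> l2 ->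
  L - 2 * (rate_error c N / N%:R) - L * N%:R^-1
    + vertex_value g (beta * a1 * gamma `^ g) (beta * a2 * gamma `^ g)
        (v1 N / N%:R) (v2 N / N%:R) @[N --> \oo] -->
  L + vertex_value g (beta * a1 * gamma `^ g) (beta * a2 * gamma `^ g) l1 l2.
Proof.
move=> v10 v20 vl1 vl2.
have nn (v : nat -> R) : (\forall N \near \oo, 0 <= v N) ->
    \forall N \near \oo, 0 <= v N / N%:R.
  by apply: filterS => N vN; rewrite divr_ge0.
apply: cvgD; last first.
  by apply: cvg_vertex_value => //; (exact: cvg_cst || exact: nn).
rewrite -[X in _ --> X]subr0 -[X in _ --> X - _]subr0.
rewrite -[X in _ --> _ - X - _](mulr0 2) -[X in _ --> _ - _ - X](mulr0 L).
apply: cvgB; last by apply: cvgMr; exact: cvg_natr_inv.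
apply: cvgB; first exact: cvg_cst.
by apply: cvgMr; exact: cvg_rate_error.
Qed.
End exponents.

(** * Tails of the driving variables at a prescribed cost *)

Section levels.
Context (R : realType) (gamma : R) (gamma_gt0 : 0 < gamma) (gamma_lt1 : gamma < 1).

(** The nonnegative value of cost [v]. *)
Definition level (gamma : R) (N : nat) (v : R) : R :=
  N%:R * (gamma * (v / N%:R)) `^ (1 / gamma).

Lemma level_ge0 N v : 0 <= level gamma N v.
Proof. by rewrite mulr_ge0// powR_ge0. Qed.

Lemma cost_level N v : (0 < N)%N -> 0 <= v -> cost gamma N (level gamma N v) = v.
Proof.
move=> N0 v0; have N0' : 0 < N%:R :> R by rewrite ltr0n.
have x0 : 0 <= gamma * (v / N%:R) by rewrite mulr_ge0 ?divr_ge0// ltW.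
rewrite costE// ger0_norm ?level_ge0// /level powRM ?powR_ge0//.
rewrite -powRrM mul1r mulVf ?gt_eqF// powRr1//.
have NN : N%:R `^ gamma * N%:R `^ (1 - gamma) = N%:R :> R.
  rewrite -powRD; last by rewrite (gt_eqF N0') implybT.
  by rewrite subrKC powRr1.
rewrite (_ : _ / gamma = N%:R `^ gamma * N%:R `^ (1 - gamma) * (v / N%:R)).
  by rewrite NN; field; rewrite gt_eqF.
by field; rewrite !gt_eqF.
Qed.

(** Each of z = x, y satisfies z / (x + y) <= (z / (x + y))^gamma, as the
    quotient lies in [0, 1]; the two quotients sum to 1. *)
Lemma powRD_le (x y : R) : 0 <= x -> 0 <= y -> (x + y) `^ gamma <= x `^ gamma + y `^ gamma.
Proof.
move=> x0 y0; have [->|x_neq0] := eqVneq x 0.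
  by rewrite add0r lerDr powR_ge0.
have s0 : 0 < x + y by rewrite ltr_pwDl// lt_neqAle eq_sym x_neq0.
have part z : 0 <= z -> z <= x + y -> z / (x + y) * (x + y) `^ gamma <= z `^ gamma.
  move=> z0 zs; have [->|z_neq0] := eqVneq z 0; first by rewrite !mul0r powR_ge0.
  have z1 : 0 < z by rewrite lt_neqAle eq_sym z_neq0.
  have le_part : z / (x + y) <= (z / (x + y)) `^ gamma.
    apply: ger1_powR; rewrite ?(ltW gamma_lt1)// divr_gt0//=.
    by rewrite ler_pdivrMr// mul1r.
  apply: (le_trans (ler_wpM2r (powR_ge0 _ _) le_part)).
  by rewrite -powRM ?divfK ?divr_ge0// ?(ltW s0)// gt_eqF.
have -> : (x + y) `^ gamma = x / (x + y) * (x + y) `^ gamma + y / (x + y) * (x + y) `^ gamma.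
  by field; rewrite gt_eqF.
by apply: lerD; apply: part => //; rewrite ?lerDl ?lerDr.
Qed.

Lemma costD1_le N t : (0 < N)%N -> 0 <= t ->
  cost gamma N (t + 1) <= cost gamma N t + N%:R `^ (1 - gamma) / gamma.
Proof.
move=> N0 t0; rewrite !costE// !ger0_norm ?addr_ge0//.
rewrite -mulrDl ler_pM2r ?invr_gt0// -[X in _ <= _ + X]mul1r -mulrDl.
rewrite ler_wpM2r ?powR_ge0//.
have := powRD_le t0 ler01; by rewrite powR1.
Qed.

End levels.

(** Computed from the density, hence the same number for all variables of the
    model of parameter [N]. *)
Section tail_prob.
Context d (T : measurableType d) (R : realType) (P : probability T R)
  (gamma : R) (gamma_gt0 : 0 < gamma) (gamma_lt1 : gamma < 1).

Definition tail_prob (gamma : R) (N : nat) (t : R) : R :=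
  fine (\int[lebesgue_measure]_(x in `]-oo, (- t)%R]) (driving_density N gamma x)%:E)%E.

Lemma tail_probE N (X : {RV P >-> R}) t : has_density X (driving_density N gamma) ->
  P (X @^-1` `]-oo, - t]) = (tail_prob gamma N t)%:E.
Proof.
move=> hX; rewrite /tail_prob fineK; first exact: hX.
rewrite -hX//; exact: fin_num_measure.
Qed.

(** Density constants increase with the parameter, so the one of
    parameter 2 serves for all N. *)
Lemma tail_prob_level_ge N (X X2 : {RV P >-> R}) v : (2 <= N)%N -> 0 <= v ->
  has_density X (driving_density N gamma) ->
  has_density X2 (driving_density 2 gamma) ->
  N%:R ^+ 2 * expR (- (v + rate_error gamma (density_const gamma 2) N))
    <= tail_prob gamma N (level gamma N v).
Proof.
move=> N2 v0 hX hX2.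
have N0 : (0 < N)%N by rewrite (leq_trans _ N2).
have N0' : 0 < N%:R :> R by rewrite ltr0n.
have K0 := density_const_gt0 hX2.
have t0 := level_ge0 gamma N v.
rewrite -lee_fin -(tail_probE _ hX); apply: le_trans (lower_tail gamma_gt0 t0 hX).
rewrite lee_fin /rate_error; set K := density_const gamma 2 in K0 *.
rewrite (_ : - (v + _) = ln K - ln (N%:R ^+ 2) + - (v + N%:R `^ (1 - gamma) / gamma)); last first.
  by rewrite lnXn//; ring.
rewrite expRD expRB !lnK ?posrE ?exprn_gt0// mulrA (mulrC _ (K / _)) divfK; last first.
  by rewrite gt_eqF// exprn_gt0.
apply: ler_pM; rewrite ?expR_ge0 ?(ltW K0)//.
  rewrite (density_constE gamma_gt0 N0) ler_peMl ?(ltW K0)//.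
  exact: tilt_const_ge1.
rewrite ler_expR lerN2; apply: le_trans (costD1_le _ _ N0 t0) _ => //.
by rewrite cost_level.
Qed.
End tail_prob.

(** * The almost sure limit *)

Section grem.
Context (R : realType) (d : measure_display)
  (T : measurableType d) (P : probability T R)
  (gamma p1 p2 : R) (k1 k2 : nat -> nat)
  (xi : forall N : nat, grem_index (k1 N) (k2 N) -> {RV P >-> R})
  (gamma_gt0 : 0 < gamma) (gamma_lt1 : gamma < 1)
  (k1k2 : forall N, (2 <= N)%N -> (k1 N + k2 N)%N = N)
  (k1_cvg : (k1 N)%:R / N%:R @[N --> \oo] --> p1)
  (p1_gt0 : 0 < p1)
  (xi_indep : forall N, (2 <= N)%N -> mutually_independent (xi N))
  (xi_density : forall N, (2 <= N)%N -> forall i,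
    has_density (xi N i) (driving_density N gamma)).

Arguments xi : clear implicits.

Local Notation L := (ln (2 : R)).
Local Notation g := (1 / gamma).

Let i0 : grem_index (k1 2) (k2 2) := inl [ffun=> true].
Let X2 : {RV P >-> R} := xi 2 i0.
Let X2_density : has_density X2 (driving_density 2 gamma) := xi_density (leqnn 2) i0.

(** Markov's inequality; the events do not involve beta, a1 or a2. *)
Lemma ae_tilted_sums : {ae P, forall w, \forall N \near \oo,
  tilted_sum1 gamma N (fun i => xi N i w) <= tilt_bound1 gamma k1 N /\
  tilted_sum gamma N (fun i => xi N i w) <= tilt_bound gamma k1 k2 N}.
Proof.
pose B1 N := [set w | tilt_bound1 gamma k1 N <= tilted_sum1 gamma N (fun i => xi N i w)].
pose B N := [set w | tilt_bound gamma k1 k2 N <= tilted_sum gamma N (fun i => xi N i w)].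
have mB1 N : measurable (B1 N).
  rewrite (_ : B1 N = (fun w => tilted_sum1 gamma N (fun i => xi N i w)) @^-1`
      `[tilt_bound1 gamma k1 N, +oo[%classic).
    by rewrite -[_ @^-1` _]setTI; exact: measurable_tilted_sum1.
  by apply/seteqP; split => w /=; rewrite in_itv/= andbT.
have mB N : measurable (B N).
  rewrite (_ : B N = (fun w => tilted_sum gamma N (fun i => xi N i w)) @^-1`
      `[tilt_bound gamma k1 k2 N, +oo[%classic).
    by rewrite -[_ @^-1` _]setTI; exact: measurable_tilted_sum.
  by apply/seteqP; split => w /=; rewrite in_itv/= andbT.
have PB1 N : (2 <= N)%N -> (P (B1 N) <= (1 / N%:R ^+ 2)%:E)%E.
  move=> N2; have N0 : (0 < N)%N by rewrite (leq_trans _ N2).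
  rewrite div1r; apply: (tilted_sum1_tail gamma_gt0 N0 (xi_density N2) X2_density).
  by rewrite exprn_gt0// ltr0n.
have PB N : (2 <= N)%N -> (P (B N) <= (1 / N%:R ^+ 2)%:E)%E.
  move=> N2; have N0 : (0 < N)%N by rewrite (leq_trans _ N2).
  rewrite div1r; apply: (tilted_sum_tail gamma_gt0 N0 (xi_indep N2) (xi_density N2) X2_density).
  by rewrite exprn_gt0// ltr0n.
apply: filterS2 (borel_cantelli_sqr mB1 PB1) (borel_cantelli_sqr mB PB) => w.
apply: filterS2 => N /negP; rewrite -ltNge => /ltW h1 /negP; rewrite -ltNge => /ltW h2.
by split.
Qed.

Lemma ae_partition_function_le (a1 a2 : R) : 0 <= a1 -> 0 <= a2 ->
  {ae P, forall w, forall beta : R, 0 <= beta -> \forall N \near \oo,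
    1 / N%:R * ln (partition_function a1 a2 (fun i => xi N i w) beta) <=
    ln (tilt_bound gamma k1 k2 N) / N%:R + vertex_max g
      (beta * a1 * (gamma / tilt_rate gamma N) `^ g)
      (beta * a2 * (gamma / tilt_rate gamma N) `^ g)
      (ln (tilt_bound1 gamma k1 N) / N%:R) (ln (tilt_bound gamma k1 k2 N) / N%:R)}.
Proof.
move=> a10 a20; apply: filterS ae_tilted_sums => w sums beta beta0.
near=> N; have N3 : (2 < N)%N by near: N; exact: nbhs_infty_ge.
have [s1 s2] : tilted_sum1 gamma N (fun i => xi N i w) <= tilt_bound1 gamma k1 N /\
  tilted_sum gamma N (fun i => xi N i w) <= tilt_bound gamma k1 k2 N by near: N.
apply: ln_partition_function_le => //.
by apply: tilt_bound1_le => //; rewrite (ltnW N3).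
Unshelve. all: by end_near. Qed.

(** The condition on [v1] makes the expected number of first blocks below
    their level at least N^2, the one on [v1 + v2] does so for configurations;
    then at least half of the expected number of configurations is present. The
    levels may depend on N, so that they can approach a vertex without a
    further limit. *)
Lemma ae_partition_function_ge (a1 a2 : R) (v1 v2 : nat -> R) : 0 <= a1 -> 0 <= a2 ->
  let r := rate_error gamma (density_const gamma 2) in
  (\forall N \near \oo, 0 <= v1 N) -> (\forall N \near \oo, 0 <= v2 N) ->
  (\forall N \near \oo, v1 N + r N <= (k1 N)%:R * L) ->
  (\forall N \near \oo, v1 N + v2 N + 2 * r N <= N%:R * L) ->
  {ae P, forall w, forall beta : R, 0 <= beta -> \forall N \near \oo,
    L - 2 * (r N / N%:R) - L * N%:R^-1
      + vertex_value g (beta * a1 * gamma `^ g) (beta * a2 * gamma `^ g)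
        (v1 N / N%:R) (v2 N / N%:R) <=
    1 / N%:R * ln (partition_function a1 a2 (fun i => xi N i w) beta)}.
Proof.
have arith1 (x y z n : R) : x + y + 2 * z <= n -> 0 <= n + (- (x + z) + - (y + z)).
  by lra.
have arith2 (n l e x y f1 f2 c1 c2 b G y1 y2 : R) : 0 < n ->
    - (x + e) <= f1 -> - (y + e) <= f2 ->
    n * (l - 2 * (e / n) - l * n^-1 +
      (b * c1 * G * y1 + b * c2 * G * y2 - x / n - y / n)) <=
    n * l + (f1 + f2) - l + b * (c1 * (n * (G * y1)) + c2 * (n * (G * y2))).
  move=> n0 h1 h2.
  rewrite (_ : n * _ = n * l - 2 * e - l - x - y +
    b * (c1 * (n * (G * y1)) + c2 * (n * (G * y2)))); last first.
    by field; rewrite gt_eqF.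
  by rewrite lerD2r; lra.
move=> a10 a20 r v10 v20 v1r v12r.
pose t v N := level gamma N (v N).
pose q v N := tail_prob gamma N (t v N).
pose I v N := `]-oo, (- t v N)]%classic.
pose m N := 2 ^+ (k1 N + k2 N) * (q v1 N * q v2 N).
(* The exceptional events: at most half of the expected number of
   configurations have both variables below their levels. *)
pose B N := [set w | \sum_s \1_(block_event (xi N) (I v1 N) (I v2 N) s) w <= m N / 2].
have mI v N : measurable (I v N) by exact: measurable_itv.
have mB N : measurable (B N).
  rewrite (_ : B N = (fun w => \sum_s \1_(block_event (xi N) (I v1 N) (I v2 N) s) w)
      @^-1` `]-oo, m N / 2]%classic).
    rewrite -[_ @^-1` _]setTI; apply: measurable_sum => // s.
    by apply: measurable_indic; exact: measurable_block_event.
  by apply/seteqP; split => w /=; rewrite in_itv.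
have qge v N : (2 <= N)%N -> 0 <= v N -> N%:R ^+ 2 * expR (- (v N + r N)) <= q v N.
  by move=> N2 vN; exact: (tail_prob_level_ge gamma_gt0 gamma_lt1 N2 vN
    (xi_density N2 (inl [ffun=> true])) X2_density).
have q_gt0 v N : (2 <= N)%N -> 0 <= v N -> 0 < q v N.
  move=> N2 vN; apply: lt_le_trans (qge _ _ N2 vN).
  by rewrite mulr_gt0 ?expR_gt0// exprn_gt0// ltr0n (leq_trans _ N2).
have lnq v N : (2 <= N)%N -> 0 <= v N -> - (v N + r N) <= ln (q v N).
  move=> N2 vN; rewrite -ler_expR lnK ?posrE ?q_gt0//.
  apply: le_trans (qge _ _ N2 vN); rewrite ler_peMl ?expR_ge0//.
  by rewrite exprn_ege1// ler1n (leq_trans _ N2).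
have expL n : 2 ^+ n = expR (n%:R * L) :> R.
  by rewrite mulr_natl -lnXn// lnK ?posrE ?exprn_gt0.
have e1 (x : R) : 0 <= x -> 1 <= expR x by move=> x0; rewrite -expR0 ler_expR.
have PB : \forall N \near \oo, (P (B N) <= (8 / N%:R ^+ 2)%:E)%E.
  near=> N; have N2 : (2 <= N)%N by near: N; exact: nbhs_infty_ge.
  have N0 : 0 < N%:R :> R by rewrite ltr0n (leq_trans _ N2).
  have v1N : 0 <= v1 N by near: N.
  have v2N : 0 <= v2 N by near: N.
  have v1rN : v1 N + r N <= (k1 N)%:R * L by near: N.
  have v12rN : v1 N + v2 N + 2 * r N <= N%:R * L by near: N.
  have Pq v i : P (xi N i @^-1` I v N) = (q v N)%:E.
    exact: tail_probE (xi_density N2 i).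
  have := block_count_lower_tail (xi_indep N2) (mI v1 N) (mI v2 N)
    (fun s => Pq v1 (inl s)) (fun s => Pq v2 (inr s)) (q_gt0 v1 N N2 v1N) (q_gt0 v2 N N2 v2N).
  move/le_trans; apply; rewrite lee_fin.
  have b1 : (2 ^+ k1 N * q v1 N)^-1 <= N%:R ^- 2.
    rewrite lef_pV2 ?posrE ?mulr_gt0 ?q_gt0 ?exprn_gt0//.
    apply: le_trans (ler_wpM2l _ (qge _ _ N2 v1N)); last by rewrite exprn_ge0.
    rewrite mulrCA ler_peMr ?exprn_ge0// expL -expRD e1//.
    by rewrite subr_ge0.
  have b2 : (2 ^+ (k1 N + k2 N) * (q v1 N * q v2 N))^-1 <= N%:R ^- 2.
    rewrite lef_pV2 ?posrE ?mulr_gt0 ?q_gt0 ?exprn_gt0//.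
    have := ler_pM _ _ (qge _ _ N2 v1N) (qge _ _ N2 v2N).
    rewrite !mulr_ge0 ?expR_ge0 ?exprn_ge0// => /(_ isT isT) qq.
    apply: le_trans (ler_wpM2l _ qq); last by rewrite exprn_ge0.
    rewrite mulrACA -expRD mulrCA -mulrA ler_peMr ?exprn_ge0//.
    apply: mulr_ege1; first by rewrite exprn_ege1// ler1n (leq_trans _ N2).
    rewrite expL -expRD k1k2// e1//.
    exact: arith1.
  apply: le_trans (ler_wpM2l _ (lerD b1 b2)) _ => //.
  by rewrite le_eqVlt; apply/orP; left; apply/eqP; field; rewrite gt_eqF.
apply: filterS (borel_cantelli_sqr_near _ mB PB) => // w Bw beta beta0.
near=> N; have N2 : (2 <= N)%N by near: N; exact: nbhs_infty_ge.
have N0 : 0 < N%:R :> R by rewrite ltr0n (leq_trans _ N2).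
have v1N : 0 <= v1 N by near: N.
have v2N : 0 <= v2 N by near: N.
have /negP : ~ B N w by near: N.
rewrite -ltNge => count.
have m0 : 0 < m N by rewrite !mulr_gt0 ?exprn_gt0 ?q_gt0.
have Zge : m N / 2 * expR (beta * (a1 * t v1 N + a2 * t v2 N)) <=
    partition_function a1 a2 (fun i => xi N i w) beta.
  apply: partition_function_ge => //; apply: le_trans (ltW count) _.
  rewrite le_eqVlt; apply/orP; left; apply/eqP; apply: eq_bigr => s _.
  rewrite indicE; congr (_%:R); congr nat_of_bool.
  apply/idP/andP => [|[x1 x2]].
    by rewrite inE => -[]; rewrite /preimage /I /= !in_itv.
  by rewrite inE; split; rewrite /preimage /I /= in_itv.
apply: (@le_trans _ _ (1 / N%:R *
    ln (m N / 2 * expR (beta * (a1 * t v1 N + a2 * t v2 N))))); last first.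
  rewrite ler_pM2l ?divr_gt0// ler_ln// posrE ?partition_function_gt0//.
  by rewrite mulr_gt0 ?expR_gt0// divr_gt0.
rewrite lnM ?posrE ?expR_gt0 ?divr_gt0// expRK ln_div ?posrE//.
rewrite /m lnM ?posrE ?mulr_gt0 ?exprn_gt0 ?q_gt0// lnM ?posrE ?q_gt0//.
rewrite expL expRK k1k2//.
rewrite (div1r N%:R) ler_pdivlMl//.
have tE v : 0 <= v N -> t v N = N%:R * (gamma `^ g * (v N / N%:R) `^ g).
  by move=> vN; rewrite /t /level powRM ?divr_ge0// ltW.
rewrite !tE// /vertex_value.
apply: arith2 => //; exact: lnq.
Unshelve. all: by end_near. Qed.
End grem.

Section free_energy.
Context (R : realType) (d : measure_display)
  (T : measurableType d) (P : probability T R)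
  (gamma p1 p2 : R) (k1 k2 : nat -> nat)
  (xi : forall N : nat, grem_index (k1 N) (k2 N) -> {RV P >-> R})
  (gamma_gt0 : 0 < gamma) (gamma_lt1 : gamma < 1)
  (k1k2 : forall N, (2 <= N)%N -> (k1 N + k2 N)%N = N)
  (k1_cvg : (k1 N)%:R / N%:R @[N --> \oo] --> p1)
  (k2_cvg : (k2 N)%:R / N%:R @[N --> \oo] --> p2)
  (p1_gt0 : 0 < p1)
  (xi_indep : forall N, (2 <= N)%N -> mutually_independent (xi N))
  (xi_density : forall N, (2 <= N)%N -> forall i,
    has_density (xi N i) (driving_density N gamma)).
Arguments xi : clear implicits.

Local Notation L := (ln (2 : R)).
Local Notation g := (1 / gamma).
Local Notation r := (rate_error gamma (density_const gamma 2)).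

Lemma proportions_sum1 : p1 + p2 = 1.
Proof.
have h : (fun N => (k1 N)%:R / N%:R + (k2 N)%:R / N%:R : R) @ \oo --> (1 : R).
  apply: (cvg_eq_from (m := 2) (v := fun=> 1)); last exact: cvg_cst.
  move=> N N2; rewrite -mulrDl -natrD k1k2// mulfV// pnatr_eq0 -lt0n.
  exact: leq_trans N2.
rewrite -(cvg_lim (@Rhausdorff R) (cvgD k1_cvg k2_cvg)).
exact: (cvg_lim (@Rhausdorff R) h).
Qed.

Lemma rate_error_ge0 (c : R) : 0 < c -> \forall N \near \oo, 0 <= rate_error gamma c N.
Proof.
move=> c0; near=> N; have N1 : (1 <= N)%N by near: N; exact: nbhs_infty_ge.
have cN : c <= N%:R by near: N; exact: nbhs_infty_ger.
have N0 : 0 < N%:R :> R by rewrite ltr0n.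
have l1 : ln c <= ln N%:R by rewrite ler_ln ?posrE.
have l0 : 0 <= ln N%:R :> R by rewrite ln_ge0// ler1n.
have e0 : 0 <= N%:R `^ (1 - gamma) / gamma by rewrite divr_ge0 ?powR_ge0// ltW.
by rewrite /rate_error; lra.
Unshelve. all: by end_near. Qed.

Lemma rate_error_le_entropy1 (c : R) :
  \forall N \near \oo, 2 * rate_error gamma c N <= (k1 N)%:R * L.
Proof.
have L0 : 0 < L by rewrite ln_gt0// ltr1n.
have lim : (k1 N)%:R / N%:R * L - 2 * (rate_error gamma c N / N%:R) @[N --> \oo] --> p1 * L - 2 * 0.
  apply: cvgB; first exact: cvgMl.
  by apply: cvgMr; exact: cvg_rate_error.
have pos : 0 < p1 * L - 2 * 0 by rewrite mulr0 subr0 mulr_gt0.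
have ev := cvgr_gt _ lim 0 pos.
near=> N; have N1 : (1 <= N)%N by near: N; exact: nbhs_infty_ge.
have N0 : 0 < N%:R :> R by rewrite ltr0n.
have : 0 < (k1 N)%:R / N%:R * L - 2 * (rate_error gamma c N / N%:R) by near: N; exact: ev.
rewrite mulrAC mulrA -mulrBl pmulr_lgt0 ?invr_gt0// subr_gt0; exact: ltW.
Unshelve. all: by end_near. Qed.

(** Four choices of cost levels approach the four vertices from
    below the entropy, and the largest of the lower bounds meets the upper
    bound. *)
Theorem ae_free_energy (a1 a2 : R) : 0 <= a1 -> 0 <= a2 ->
  {ae P, forall w, forall beta : R, 0 <= beta ->
    1 / N%:R * ln (partition_function a1 a2 (fun i => xi N i w) beta)
      @[N --> \oo] -->
    L + vertex_max g (beta * a1 * gamma `^ g) (beta * a2 * gamma `^ g) (p1 * L) L}.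
Proof.
move=> a10 a20.
have L0 : 0 < L by rewrite ln_gt0// ltr1n.
have K0 : 0 < density_const gamma 2.
  exact: density_const_gt0 (xi_density (leqnn 2) (inl [ffun=> true])).
have r0 := rate_error_ge0 K0.
have rk := rate_error_le_entropy1 (density_const gamma 2).
have kL : \forall N \near \oo, (k1 N)%:R * L + (k2 N)%:R * L = N%:R * L.
  by exists 2%N => // N /= N2; rewrite -mulrDl -natrD k1k2.
have k0 (k : nat -> nat) N : 0 <= (k N)%:R * L by rewrite mulr_ge0// ltW.
(* Cost levels, in units where the entropies are k1 L, k2 L and N L: the
   pairs (z, z), (b1, z), (b1, b2), (z, b) approach the vertices, with the
   error terms subtracted where the entropy would be exhausted. *)
pose z (N : nat) : R := 0.
pose b1 N : R := (k1 N)%:R * L - 2 * r N.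
pose b2 N : R := (k2 N)%:R * L.
pose b N : R := N%:R * L - 2 * r N.
have z0 : \forall N \near \oo, 0 <= z N by exact: nearW.
have b10 : \forall N \near \oo, 0 <= b1 N.
  by apply: filterS rk => N; rewrite subr_ge0.
have b20 : \forall N \near \oo, 0 <= b2 N by apply: nearW => N; exact: k0.
have b0 : \forall N \near \oo, 0 <= b N.
  apply: filterS2 rk kL => N rN kN; rewrite subr_ge0 -kN.
  by apply: (le_trans rN); rewrite lerDl.
have zr : \forall N \near \oo, z N + r N <= (k1 N)%:R * L.
  by apply: filterS2 rk r0 => N; rewrite /z; lra.
have b1r : \forall N \near \oo, b1 N + r N <= (k1 N)%:R * L.
  by apply: filterS r0 => N; rewrite /b1; lra.
have zz : \forall N \near \oo, z N + z N + 2 * r N <= N%:R * L.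
  by apply: filterS2 rk kL => N; have := k0 k2 N; rewrite /z; lra.
have b1z : \forall N \near \oo, b1 N + z N + 2 * r N <= N%:R * L.
  by apply: filterS kL => N; have := k0 k2 N; rewrite /b1 /z; lra.
have b1b2 : \forall N \near \oo, b1 N + b2 N + 2 * r N <= N%:R * L.
  by apply: filterS kL => N; rewrite /b1 /b2; lra.
have zb : \forall N \near \oo, z N + b N + 2 * r N <= N%:R * L.
  by apply: nearW => N; rewrite /z /b; lra.
have clim := cvg_rate_error gamma_gt0 gamma_lt1 (density_const gamma 2).
have zl : z N / N%:R @[N --> \oo] --> (0 : R).
  by rewrite /z; under eq_fun do rewrite mul0r; exact: cvg_cst.
have b1l : b1 N / N%:R @[N --> \oo] --> p1 * L.
  apply: (cvg_eq_from (m := 1) (v := fun N => (k1 N)%:R / N%:R * L - 2 * (r N / N%:R))).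
    by move=> N N1; rewrite /b1; ring.
  rewrite -[X in _ --> X]subr0 -[X in _ --> _ - X](mulr0 2).
  by apply: cvgB; [exact: cvgMl|exact: cvgMr].
have b2l : b2 N / N%:R @[N --> \oo] --> L - p1 * L.
  have -> : L - p1 * L = p2 * L.
    by rewrite -[X in X - _]mul1r -proportions_sum1 mulrDl addrAC subrr add0r.
  apply: (cvg_eq_from (m := 1) (v := fun N => (k2 N)%:R / N%:R * L)).
    by move=> N N1; rewrite /b2; ring.
  exact: cvgMl.
have bl : b N / N%:R @[N --> \oo] --> L.
  apply: (cvg_eq_from (m := 1) (v := fun N => L - 2 * (r N / N%:R))).
    move=> N N1; rewrite /b; field.
    by rewrite gt_eqF// ltr0n.
  rewrite -[X in _ --> X]subr0 -[X in _ --> _ - X](mulr0 2).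
  by apply: cvgB; [exact: cvg_cst|exact: cvgMr].
have lo := ae_partition_function_ge gamma_gt0 gamma_lt1 k1k2 xi_indep xi_density a10 a20.
have up := ae_partition_function_le gamma_gt0 gamma_lt1 xi_indep xi_density a10 a20.
have FP : Filter (nbhs (almost_everywhere P)) by exact: _.
have lo4 := filterI (filterI (lo z z z0 z0 zr zz) (lo b1 z b10 z0 b1r b1z))
  (filterI (lo b1 b2 b10 b20 b1r b1b2) (lo z b z0 b0 zr zb)).
have all5 := filterI up (lo4 FP FP FP).
move: (all5 FP).
apply: filterS => w [hi [[lo00 lo10] [lo12 lo02]]] beta beta0.
have cu := cvg_upper_bound gamma_gt0 gamma_lt1 k1k2 k1_cvg (beta := beta) (a1 := a1) (a2 := a2).
pose low v1 v2 N := L - 2 * (r N / N%:R) - L * N%:R^-1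
  + vertex_value g (beta * a1 * gamma `^ g) (beta * a2 * gamma `^ g)
      (v1 N / N%:R) (v2 N / N%:R).
apply: (squeeze_cvgr (f := fun N => Num.max (Num.max (low z z N) (low b1 z N))
  (Num.max (low b1 b2 N) (low z b N))) _ _ cu).
  near=> N; apply/andP; split; last by near: N; exact: hi.
  rewrite !ge_max; apply/andP; split; apply/andP; split.
  - by near: N; exact: lo00.
  - by near: N; exact: lo10.
  - by near: N; exact: lo12.
  - by near: N; exact: lo02.
rewrite /vertex_max !addr_maxr; apply: cvg_max; apply: cvg_max.
- exact: cvg_lower_bound.
- exact: cvg_lower_bound.
- exact: cvg_lower_bound.
- exact: cvg_lower_bound.
Unshelve. all: by end_near. Qed.
End free_energy.

(** * Comparison of the vertex values *)

Section regimes.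
Context (R : realType).

Section critical.
Context (gamma a x : R) (gamma_gt0 : 0 < gamma) (gamma_lt1 : gamma < 1) (a_gt0 : 0 < a).

Lemma critical_beta0 : critical_beta gamma a 0 = +oo%E.
Proof.
rewrite /critical_beta powR0; first by rewrite mulr0 inve0 mul1e.
by rewrite gt_eqF// divr_gt0// subr_gt0.
Qed.

Lemma critical_betaE : 0 < x ->
  critical_beta gamma a x = ((a * gamma `^ (1 / gamma) * x `^ ((1 - gamma) / gamma))^-1)%:E.
Proof.
move=> x0; rewrite /critical_beta inver gt_eqF ?mul1e//.
by rewrite !mulr_gt0 ?powR_gt0.
Qed.

Lemma le_critical_beta (b : R) : 0 < x ->
  (b%:E <= critical_beta gamma a x)%E =
  (b * gamma `^ (1 / gamma) * (a * x `^ ((1 - gamma) / gamma)) <= 1).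
Proof.
move=> x0; rewrite critical_betaE// lee_fin -div1r ler_pdivlMr ?mulr_gt0 ?powR_gt0//.
by congr (_ <= _); ring.
Qed.

Lemma ge_critical_beta (b : R) : 0 < x ->
  (critical_beta gamma a x <= b%:E)%E =
  (1 <= b * gamma `^ (1 / gamma) * (a * x `^ ((1 - gamma) / gamma))).
Proof.
move=> x0; rewrite critical_betaE// lee_fin -div1r ler_pdivrMr ?mulr_gt0 ?powR_gt0//.
by congr (_ <= _); ring.
Qed.
End critical.

End regimes.

Section phases.
Context (R : realFieldType) (D P1 P2 x1 x2 x : R) (D_ge0 : 0 <= D) (P1_gt0 : 0 < P1)
  (P2_ge0 : 0 <= P2) (x1_gt0 : 0 < x1) (x2_ge0 : 0 <= x2) (x2_le : x2 <= x).

(** The vertex values in terms of the quantities that are compared: D is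
    beta gamma^(1/gamma), P1 and P2 are the block entropies p_i ln 2, and x1,
    x2, x are a1 P1^h, a2 P2^h, a2 (P1 + P2)^h with h = (1-gamma)/gamma. At the
    inverse temperature [critical_beta] built from a slope, D times that slope
    is 1. *)
Definition phase_max : R :=
  Num.max (Num.max 0 (D * (x1 * P1) - P1))
    (Num.max (D * (x1 * P1 + x2 * P2) - (P1 + P2)) (D * (x * (P1 + P2)) - (P1 + P2))).

Lemma phase_maxE (e : R) :
  e \in [:: 0; D * (x1 * P1) - P1; D * (x1 * P1 + x2 * P2) - (P1 + P2);
      D * (x * (P1 + P2)) - (P1 + P2)] ->
  0 <= e -> D * (x1 * P1) - P1 <= e ->
  D * (x1 * P1 + x2 * P2) - (P1 + P2) <= e ->
  D * (x * (P1 + P2)) - (P1 + P2) <= e -> phase_max = e.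
Proof.
move=> ein l1 l2 l3 l4; apply/eqP; rewrite eq_le !ge_max l1 l2 l3 l4/=.
by move: ein; rewrite !inE !le_max => /or4P[] /eqP ->; rewrite lexx ?orbT.
Qed.

Section first_regime.
Context (short : x * (P1 + P2) <= x1 * P1 + x2 * P2).

(** In the first regime the first block freezes before the second one. *)
Lemma block_slopes_le : x2 <= x1.
Proof.
rewrite -(ler_pM2r P1_gt0).
have : x2 * (P1 + P2) <= x * (P1 + P2) by rewrite ler_wpM2r// addr_ge0// ltW.
by move: short; rewrite !mulrDr; lra.
Qed.

Lemma phase_max_high1 : D * x1 <= 1 -> phase_max = 0.
Proof.
move=> Dx1; have x21 := block_slopes_le.
have Dx2 : D * x2 <= 1 by apply: le_trans Dx1; rewrite ler_wpM2l.
have h1 := ler_wpM2r (ltW P1_gt0) Dx1; have h2 := ler_wpM2r P2_ge0 Dx2.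
have h3 := ler_wpM2l D_ge0 short.
by apply: phase_maxE; rewrite ?inE ?eqxx//; lra.
Qed.

Lemma phase_max_middle1 : 1 <= D * x1 -> D * x2 <= 1 -> phase_max = D * (x1 * P1) - P1.
Proof.
move=> Dx1 Dx2.
have h1 := ler_wpM2r (ltW P1_gt0) Dx1; have h2 := ler_wpM2r P2_ge0 Dx2.
have h3 := ler_wpM2l D_ge0 short.
by apply: phase_maxE; rewrite ?inE ?eqxx ?orbT//; lra.
Qed.

Lemma phase_max_low1 : 1 <= D * x2 ->
  phase_max = D * (x1 * P1 + x2 * P2) - (P1 + P2).
Proof.
move=> Dx2; have x21 := block_slopes_le.
have Dx1 : 1 <= D * x1 by apply: le_trans Dx2 _; rewrite ler_wpM2l.
have h1 := ler_wpM2r (ltW P1_gt0) Dx1; have h2 := ler_wpM2r P2_ge0 Dx2.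
have h3 := ler_wpM2l D_ge0 short.
by apply: phase_maxE; rewrite ?inE ?eqxx ?orbT//; lra.
Qed.
End first_regime.

Section second_regime.
Context (long : x1 * P1 + x2 * P2 < x * (P1 + P2)).

Lemma phase_max_high2 : x <= x1 -> D * x1 <= 1 -> phase_max = 0.
Proof.
move=> xx1 Dx1.
have Dx : D * x <= 1 by apply: le_trans Dx1; rewrite ler_wpM2l.
have h1 := ler_wpM2r (ltW P1_gt0) Dx1.
have h2 := ler_wpM2r (addr_ge0 (ltW P1_gt0) P2_ge0) Dx.
have h3 := ler_wpM2l D_ge0 (ltW long).
by apply: phase_maxE; rewrite ?inE ?eqxx//; lra.
Qed.

Lemma phase_max_middle2 : 1 <= D * x1 ->
  D * (x * (P1 + P2) - x1 * P1) <= P2 -> phase_max = D * (x1 * P1) - P1.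
Proof.
move=> Dx1 DP2.
have h1 := ler_wpM2r (ltW P1_gt0) Dx1.
have h3 := ler_wpM2l D_ge0 (ltW long).
by apply: phase_maxE; rewrite ?inE ?eqxx ?orbT//; lra.
Qed.

(** The second block has positive entropy here, as [long] and x <= x1 exclude
    P2 = 0; then the comparison with the middle phase forces 1 <= D x. *)
Lemma phase_max_low2 : x <= x1 ->
  P2 <= D * (x * (P1 + P2) - x1 * P1) -> phase_max = D * (x * (P1 + P2)) - (P1 + P2).
Proof.
move=> xx1 DP2.
have h3 := ler_wpM2l D_ge0 (ltW long).
have h4 : D * (x * P1) <= D * (x1 * P1) by rewrite ler_wpM2l// ler_wpM2r// ltW.
have P2_gt0 : 0 < P2.
  rewrite lt_neqAle P2_ge0 andbT; apply/eqP => P20.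
  have := ler_wpM2r (ltW P1_gt0) xx1; move: long; rewrite -P20; lra.
have Dx : 1 <= D * x by rewrite -(ler_pM2r P2_gt0); lra.
have h2 := ler_wpM2r (addr_ge0 (ltW P1_gt0) P2_ge0) Dx.
by apply: phase_maxE; rewrite ?inE ?eqxx ?orbT//; lra.
Qed.

Lemma phase_max_high3 : x1 < x -> D * x <= 1 -> phase_max = 0.
Proof.
move=> xx1 Dx.
have Dx1 : D * x1 <= 1 by apply: le_trans Dx; rewrite ler_wpM2l// ltW.
have h1 := ler_wpM2r (ltW P1_gt0) Dx1.
have h2 := ler_wpM2r (addr_ge0 (ltW P1_gt0) P2_ge0) Dx.
have h3 := ler_wpM2l D_ge0 (ltW long).
by apply: phase_maxE; rewrite ?inE ?eqxx//; lra.
Qed.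

Lemma phase_max_low3 : x1 < x -> 1 <= D * x ->
  phase_max = D * (x * (P1 + P2)) - (P1 + P2).
Proof.
move=> xx1 Dx.
have h1 : D * (x1 * P1) <= D * (x * P1).
  by rewrite ler_wpM2l// ler_wpM2r// ltW.
have h2 := ler_wpM2r P2_ge0 Dx; have h4 := ler_wpM2r (ltW P1_gt0) Dx.
have h3 := ler_wpM2l D_ge0 (ltW long).
by apply: phase_maxE; rewrite ?inE ?eqxx ?orbT//; lra.
Qed.
End second_regime.
End phases.

Lemma powR_exponent_split (R : realType) (gamma x : R) : 0 < gamma -> 0 <= x ->
  x `^ (1 / gamma) = x `^ ((1 - gamma) / gamma) * x.
Proof.
move=> gamma_gt0 x0.
rewrite (_ : (1 - gamma) / gamma = 1 / gamma - 1); last by field; rewrite gt_eqF.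
by rewrite [RHS]mulrC mulr_powRB1 ?divr_gt0.
Qed.

Lemma vertex_max_phase (R : realType) (gamma p1 p2 L a1 a2 beta : R) :
  0 < gamma -> 0 <= p1 -> 0 <= p2 -> p1 + p2 = 1 -> 0 <= L ->
  vertex_max (1 / gamma) (beta * a1 * gamma `^ (1 / gamma))
    (beta * a2 * gamma `^ (1 / gamma)) (p1 * L) L =
  phase_max (beta * gamma `^ (1 / gamma)) (p1 * L) (p2 * L)
    (a1 * (p1 * L) `^ ((1 - gamma) / gamma)) (a2 * (p2 * L) `^ ((1 - gamma) / gamma))
    (a2 * L `^ ((1 - gamma) / gamma)).
Proof.
move=> gamma_gt0 p10 p20 p12 L0.
have z : 0 `^ (1 / gamma) = 0 :> R by rewrite powR0// gt_eqF// divr_gt0.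
have LE : p1 * L + p2 * L = L by rewrite -mulrDl p12 mul1r.
have p2E : L - p1 * L = p2 * L by rewrite -[X in X - _]LE addrAC subrr add0r.
rewrite /phase_max LE /vertex_max /vertex_value p2E !z.
rewrite !(powR_exponent_split gamma_gt0) ?mulr_ge0 ?(ltW gamma_gt0)//.
set G := gamma `^ _; set h1 := _ `^ _; set h2 := (p2 * L) `^ _; set h := L `^ _.
congr (Num.max (Num.max _ _) (Num.max _ _)).
- by ring.
- by ring.
- by rewrite -[in X in _ = _ - X]LE; ring.
- by ring.
Qed.

Theorem theorem2p6p6 (R : realType) (d : measure_display)
  (T : measurableType d) (P : probability T R)
  (gamma a1 a2 p1 p2 : R) (k1 k2 : nat -> nat)
  (xi : forall N : nat, grem_index (k1 N) (k2 N) -> {RV P >-> R})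
  (gamma_gt0 : 0 < gamma) (gamma_lt1 : gamma < 1)
  (a1_gt0 : 0 < a1) (a2_gt0 : 0 < a2)
  (k1_ge1 : forall N, (2 <= N)%N -> (1 <= k1 N)%N)
  (k2_ge1 : forall N, (2 <= N)%N -> (1 <= k2 N)%N)
  (k1k2 : forall N, (2 <= N)%N -> (k1 N + k2 N)%N = N)
  (k1_cvg : (k1 N)%:R / N%:R @[N --> \oo] --> p1)
  (k2_cvg : (k2 N)%:R / N%:R @[N --> \oo] --> p2)
  (p1_gt0 : 0 < p1)
  (xi_indep : forall N, (2 <= N)%N -> mutually_independent (xi N))
  (xi_density : forall N, (2 <= N)%N -> forall i,
    has_density (xi N i) (driving_density N gamma)) :
  {ae P, forall w, forall beta : R, 0 <= beta ->
    let free_energy_is (E : R) :=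
      1 / N%:R * ln (partition_function a1 a2 (fun i => xi N i w) beta)
        @[N --> \oo] --> E in
    let L : R := ln 2 in
    let g : R := 1 / gamma in
    let h : R := (1 - gamma) / gamma in
    [/\ a2 * L `^ g <= a1 * (p1 * L) `^ g + a2 * (p2 * L) `^ g ->
        [/\ (beta%:E <= critical_beta gamma a1 (p1 * L))%E ->
              free_energy_is L,
            (critical_beta gamma a1 (p1 * L) <= beta%:E
               <= critical_beta gamma a2 (p2 * L))%E ->
              free_energy_is (p2 * L + beta * a1 * (gamma * p1 * L) `^ g)
          & (critical_beta gamma a2 (p2 * L) <= beta%:E)%E ->
              free_energy_is (beta * (a1 * (gamma * p1 * L) `^ g
                                      + a2 * (gamma * p2 * L) `^ g))],
        a2 * L `^ g > a1 * (p1 * L) `^ g + a2 * (p2 * L) `^ g ->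
        a2 * L `^ h <= a1 * (p1 * L) `^ h ->
        let beta2 : R :=
          p2 * L / (a2 * (gamma * L) `^ g - a1 * (gamma * p1 * L) `^ g) in
        [/\ (beta%:E <= critical_beta gamma a1 (p1 * L))%E ->
              free_energy_is L,
            (critical_beta gamma a1 (p1 * L) <= beta%:E <= beta2%:E)%E ->
              free_energy_is (p2 * L + beta * a1 * (gamma * p1 * L) `^ g)
          & beta2 <= beta ->
              free_energy_is (beta * a2 * (gamma * L) `^ g)]
      & a2 * L `^ g > a1 * (p1 * L) `^ g + a2 * (p2 * L) `^ g ->
        a2 * L `^ h > a1 * (p1 * L) `^ h ->
        [/\ (beta%:E <= critical_beta gamma a2 L)%E ->
              free_energy_is L
          & (critical_beta gamma a2 L <= beta%:E)%E ->
              free_energy_is (beta * a2 * (gamma * L) `^ g)]]}.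
Proof.
have L0 : 0 < ln 2 :> R by rewrite ln_gt0// ltr1n.
have p12 := proportions_sum1 k1k2 k1_cvg k2_cvg.
have p2_ge0 : 0 <= p2 by apply: (cvgr_to_ge k2_cvg); apply: nearW => N; rewrite divr_ge0.
have := ae_free_energy gamma_gt0 gamma_lt1 k1k2 k1_cvg k2_cvg p1_gt0
  xi_indep xi_density (ltW a1_gt0) (ltW a2_gt0).
apply: filterS => w + beta beta0 => /(_ beta beta0).
set free_energy := fun N : nat => _.
rewrite (vertex_max_phase _ _ _ gamma_gt0 (ltW p1_gt0) p2_ge0 p12 (ltW L0)).
move=> lim.
set L : R := ln 2 in L0 lim *; set g := 1 / gamma in lim *.
set h := (1 - gamma) / gamma in lim *.
have P1_gt0 : 0 < p1 * L by rewrite mulr_gt0.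
have P2_ge0 : 0 <= p2 * L by rewrite mulr_ge0// ltW.
have LE : p1 * L + p2 * L = L by rewrite -mulrDl p12 mul1r.
have h_gt0 : 0 < h by rewrite divr_gt0// subr_gt0.
pose G := gamma `^ g; have G_gt0 : 0 < G by rewrite powR_gt0.
(* The slopes energy / entropy of the first block, of the second block and of
   a single variable indexed by whole configurations, up to gamma^(1/gamma). *)
pose x1 := a1 * (p1 * L) `^ h; pose x2 := a2 * (p2 * L) `^ h; pose x := a2 * L `^ h.
have x1_gt0 : 0 < x1 by rewrite mulr_gt0// powR_gt0.
have x2_ge0 : 0 <= x2 by rewrite mulr_ge0 ?powR_ge0// ltW.
have x2_le : x2 <= x.
  rewrite ler_pM2l// ge0_ler_powR ?nnegrE ?(ltW h_gt0) ?(ltW L0)//.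
  by rewrite -[leRHS]LE lerDr ltW.
have X1 : a1 * (p1 * L) `^ g = x1 * (p1 * L).
  by rewrite (powR_exponent_split gamma_gt0 (ltW P1_gt0)) mulrA.
have X2 : a2 * (p2 * L) `^ g = x2 * (p2 * L).
  by rewrite (powR_exponent_split gamma_gt0 P2_ge0) mulrA.
have X : a2 * L `^ g = x * (p1 * L + p2 * L).
  by rewrite LE (powR_exponent_split gamma_gt0 (ltW L0)) mulrA.
have GX1 : a1 * (gamma * p1 * L) `^ g = G * (x1 * (p1 * L)).
  by rewrite -mulrA powRM ?(ltW gamma_gt0) ?(ltW P1_gt0)// mulrCA X1.
have GX2 : a2 * (gamma * p2 * L) `^ g = G * (x2 * (p2 * L)).
  by rewrite -mulrA powRM ?(ltW gamma_gt0)// mulrCA X2.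
have GX : a2 * (gamma * L) `^ g = G * (x * (p1 * L + p2 * L)).
  by rewrite powRM ?(ltW gamma_gt0) ?(ltW L0)// mulrCA X.
pose D := beta * G.
have D_ge0 : 0 <= D by rewrite mulr_ge0// ltW.
have conclude e E : phase_max D (p1 * L) (p2 * L) x1 x2 x = e -> L + e = E ->
    free_energy N @[N --> \oo] --> E.
  by move=> <- <-; exact: lim.
have crit1 : (beta%:E <= critical_beta gamma a1 (p1 * L))%E = (D * x1 <= 1).
  exact: le_critical_beta.
have crit1' : (critical_beta gamma a1 (p1 * L) <= beta%:E)%E = (1 <= D * x1).
  exact: ge_critical_beta.
have crit : (beta%:E <= critical_beta gamma a2 L)%E = (D * x <= 1).
  exact: le_critical_beta.
have crit' : (critical_beta gamma a2 L <= beta%:E)%E = (1 <= D * x).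
  exact: ge_critical_beta.
(* When p2 = 0 the critical value is +oo and the slope x2 is 0, so the
   condition D x2 <= 1 holds and 1 <= D x2 is excluded. *)
have crit2 : (beta%:E <= critical_beta gamma a2 (p2 * L))%E -> D * x2 <= 1.
  have [P20|P2_neq0] := eqVneq (p2 * L) 0.
    by rewrite /x2 P20 powR0 ?gt_eqF// !mulr0 ler01.
  by rewrite le_critical_beta// lt_neqAle eq_sym P2_neq0.
have crit2' : (critical_beta gamma a2 (p2 * L) <= beta%:E)%E -> 1 <= D * x2.
  have [P20|P2_neq0] := eqVneq (p2 * L) 0.
    by rewrite P20 critical_beta0// leye_eq.
  by rewrite ge_critical_beta// lt_neqAle eq_sym P2_neq0.
rewrite X1 X2 X crit1 crit1' crit crit'.
split.
- move=> short; split.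
  + move=> high; apply: (conclude 0);
      first exact: phase_max_high1.
    by rewrite addr0.
  + move=> /andP[low /crit2 high].
    apply: (conclude (D * (x1 * (p1 * L)) - p1 * L));
      first exact: phase_max_middle1.
    by rewrite -[beta * a1 * _]mulrA GX1 -[X in X + _]LE /D; ring.
  + move=> /crit2' low.
    apply: (conclude (D * (x1 * (p1 * L) + x2 * (p2 * L)) - (p1 * L + p2 * L)));
      first exact: phase_max_low1.
    by rewrite GX1 GX2 -[X in X + _]LE /D; ring.
- move=> long slopes.
  have gap_gt0 : 0 < x * (p1 * L + p2 * L) - x1 * (p1 * L).
    by rewrite subr_gt0; apply: le_lt_trans long; rewrite lerDl mulr_ge0.
  rewrite GX1 GX -mulrBr.
  have Dgap (y : R) : y * G * (x * (p1 * L + p2 * L) - x1 * (p1 * L)) =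
      y * (G * (x * (p1 * L + p2 * L) - x1 * (p1 * L))) by rewrite -(mulrA y).
  split.
  + move=> high; apply: (conclude 0);
      first exact: phase_max_high2.
    by rewrite addr0.
  + move=> /andP[low]; rewrite lee_fin ler_pdivlMr ?mulr_gt0// -Dgap => high.
    apply: (conclude (D * (x1 * (p1 * L)) - p1 * L));
      first exact: phase_max_middle2.
    by rewrite -[beta * a1 * _]mulrA GX1 -[X in X + _]LE /D; ring.
  + rewrite ler_pdivrMr ?mulr_gt0// -Dgap => low.
    apply: (conclude (D * (x * (p1 * L + p2 * L)) - (p1 * L + p2 * L)));
      first exact: phase_max_low2.
    by rewrite -[beta * a2 * _]mulrA GX -[X in X + _]LE /D; ring.
- move=> long slopes; split.
  + move=> high; apply: (conclude 0);
      first exact: phase_max_high3.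
    by rewrite addr0.
  + move=> low.
    apply: (conclude (D * (x * (p1 * L + p2 * L)) - (p1 * L + p2 * L)));
      first exact: phase_max_low3.
    by rewrite -[beta * a2 * _]mulrA GX -[X in X + _]LE /D; ring.
Qed.
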